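(* Let $m\in\mathbb{N}$, $l\in\{0,\dots,m-1\}$, $4m<N$, let $\Omega\subset\mathbb{R}^N$ be a bounded domain containing the origin, and let $D\ge\sup_{x\in\Omega}|x|$. Then for all $u\in C_0^\infty(\Omega)$ the following two inequalities hold. (i) $$\begin{aligned}\int_\Omega(\Delta^mu)^2dx\ \ge\ &\prod_{k=0}^{l}\Big(\frac{(N+4k)(N-4-4k)}{4}\Big)^2\int_\Omega\frac{(\Delta^{m-l-1}u)^2}{|x|^{4l+4}}dx\\&+\sum_{k=1}^{l}\bar\sigma(2k,N)\prod_{j=0}^{k-1}\sigma(2j,N)\sum_{i=1}^\infty\int_\Omega\frac{(\Delta^{m-k-1}u)^2}{|x|^{4k+4}}X_1^2\cdots X_i^2\,dx\\&+\Big(1+\frac{N(N-4)}{8}\Big)\sum_{i=1}^\infty\int_\Omega\frac{(\Delta^{m-1}u)^2}{|x|^4}X_1^2\cdots X_i^2\,dx.\end{aligned}$$ (ii) $$\begin{aligned}\int_\Omega|\nabla\Delta^mu|^2dx\ \ge\ &\Big(\frac{N-2}{2}\Big)^2\prod_{k=0}^{l-1}\Big(\frac{(N+2+4k)(N-6-4k)}{4}\Big)^2\int_\Omega\frac{(\Delta^{m-l}u)^2}{|x|^{4l+2}}dx\\&+\Big(\frac{N-2}{2}\Big)^2\sum_{k=2}^{l}\bar\sigma(2k-1,N)\prod_{j=0}^{k-2}\sigma(2j+1,N)\sum_{i=1}^\infty\int_\Omega\frac{(\Delta^{m-k}u)^2}{|x|^{4k+2}}X_1^2\cdots X_i^2\,dx\\&+\Big(\frac{N-2}{2}\Big)^2\Big(4+\frac{(N+2)(N-6)}{8}\Big)\sum_{i=1}^\infty\int_\Omega\frac{(\Delta^{m-1}u)^2}{|x|^6}X_1^2\cdots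 X_i^2\,dx\\&+\frac14\sum_{i=1}^\infty\int_\Omega\frac{(\Delta^mu)^2}{|x|^2}X_1^2\cdots X_i^2\,dx.\end{aligned}$$
   Context: $N$ is the space dimension. $X_1(t)=(1-\log t)^{-1}$ and $X_k(t)=X_1(X_{k-1}(t))$, $k=2,3,\dots$, for $t\in(0,1]$; in the integrals $X_i$ stands for $X_i(|x|/D)$. For $s\ge0$, $$\sigma(s,N)=\Big(\frac{(N+2s)(N-4-2s)}{4}\Big)^2,\qquad\bar\sigma(s,N)=(1+s)^2+\frac{(N+2s)(N-4-2s)}{8}.$$ Empty sums are $0$ and empty products are $1$. $\Delta^0u=u$.
   Formalization: In (ii) with l = 0 the term with (Δ^{m-1}u)²/|x|⁶ is dropped, since the inequality with it is false: for m = 1, N = 5, u(0) ≠ 0 that integral is +∞ with a positive coefficient while the left side is finite. For l ≥ 1, (ii) is as printed. *)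

(* Defs.v *)
From HB Require Import structures.
From mathcomp Require Import all_boot all_order all_algebra.
From mathcomp Require Import all_classical all_reals all_analysis.
Import Order.TTheory GRing.Theory Num.Theory.
Import numFieldNormedType.Exports.

Set Implicit Arguments.
Unset Strict Implicit.
Unset Printing Implicit Defensive.

Local Open Scope classical_set_scope.
Local Open Scope ring_scope.

(* Lebesgue measure on R^n, carried by n-tuples with the product sigma-algebra:
   the unit point mass for n = 0, then the image of
   lebesgue_measure \x (measure on R^n) under (x, t) |-> x :: t. *)
Section lebesgue_tuple.
Context {R : realType}.
Local Notation T := (measurableTypeR R).

Definition tcons n (p : T * n.-tuple T) : n.+1.-tuple T :=
  [tuple of p.1 :: p.2].

Lemma measurable_tcons n : measurable_fun [set: T * n.-tuple T] (@tcons n).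
Proof. exact: measurable_cons. Qed.

Section step.
Variables (n : nat) (mu : {sigma_finite_measure set (n.-tuple T) -> \bar R}).

Definition lebesgue_step : set (n.+1.-tuple T) -> \bar R :=
  pushforward (@lebesgue_measure R \x mu)%E (@tcons n).

Let lebesgue_step0 : lebesgue_step set0 = 0%E.
Proof. by rewrite /lebesgue_step /pushforward preimage_set0 measure0. Qed.

Let lebesgue_step_ge0 A : (0 <= lebesgue_step A)%E.
Proof. by rewrite /lebesgue_step /pushforward measure_ge0. Qed.

Let lebesgue_step_sigma_additive : semi_sigma_additive lebesgue_step.
Proof.
have mP B : measurable B -> measurable (@tcons n @^-1` B).
  by move=> mB; rewrite -[X in measurable X]setTI; exact: measurable_tcons.
move=> F mF tF mUF; rewrite /lebesgue_step /pushforward preimage_bigcup.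
apply: measure_semi_sigma_additive.
- by move=> i; exact: mP.
- apply/trivIsetP => /= i j _ _ ij; rewrite -preimage_setI.
  by move/trivIsetP : tF => /(_ _ _ _ _ ij) ->//; rewrite preimage_set0.
- by rewrite -preimage_bigcup; exact: mP.
Qed.

HB.instance Definition _ := isMeasure.Build _ _ _ lebesgue_step
  lebesgue_step0 lebesgue_step_ge0 lebesgue_step_sigma_additive.

(* The sigma-finite instance of \x in the library is shadowed by the one for
   finite measures, hence the direct argument. *)
Let lebesgue_step_sigma_finite : sigma_finite setT lebesgue_step.
Proof.
have [F TF Foo] : exists2 F : (set (T * n.-tuple T))^nat,
      setT = \bigcup_k F k &
      forall k, measurable (F k) /\ ((@lebesgue_measure R \x mu) (F k) < +oo)%E.
  have /sigma_finiteP[G [TG ndG Goo]] := sigma_finiteT (@lebesgue_measure R).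
  have /sigma_finiteP[H [TH ndH Hoo]] := sigma_finiteT mu.
  exists (fun k => G k `*` H k).
    rewrite -setXTT TG TH predeqE => -[x y]; split.
      move=> [/= [k _ Gkx] [j _ Hjy]]; exists (maxn k j) => //; split.
      - by move: x Gkx; exact/subsetPset/ndG/leq_maxl.
      - by move: y Hjy; exact/subsetPset/ndH/leq_maxr.
    by move=> [k _ [/= ? ?]]; split; exists k.
  move=> k; have [? ?] := Goo k; have [? ?] := Hoo k.
  split; first exact: measurableX.
  by rewrite product_measure1E// lte_mul_pinfty// ge0_fin_numE.
pose g (t : n.+1.-tuple T) : T * n.-tuple T := (tnth t ord0, [tuple of behead t]).
have mg : measurable_fun [set: n.+1.-tuple T] g.
  apply: measurable_fun_pair; first exact: measurable_tnth.
  exact: measurable_behead.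
have gK p : g (tcons p) = p.
  by case: p => x t; rewrite /g /tcons /=; congr pair; exact/val_inj.
exists (fun k => g @^-1` F k); first by rewrite -preimage_bigcup -TF.
move=> k; have [mFk Fkoo] := Foo k; split.
  by rewrite -[X in measurable X]setTI; exact: mg.
rewrite /lebesgue_step /pushforward (_ : _ @^-1` _ = F k)//.
by apply/seteqP; split=> p /=; rewrite gK.
Qed.

HB.instance Definition _ :=
  Measure_isSigmaFinite.Build _ _ _ lebesgue_step lebesgue_step_sigma_finite.
End step.

Fixpoint lebesgueN n : {sigma_finite_measure set (n.-tuple T) -> \bar R} :=
  match n with
  | 0 => \d_[tuple]
  | n.+1 => lebesgue_step (lebesgueN n)
  end.

End lebesgue_tuple.

Section euclidean.
Context {R : realType} {N : nat}.
Implicit Types (f u : 'rV[R]_N -> R) (x : 'rV[R]_N) (A Omega : set 'rV[R]_N).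

Definition row_of_tuple (t : N.-tuple (measurableTypeR R)) : 'rV[R]_N :=
  \row_i tnth t i.

Definition integral_rV A f : \bar R :=
  (\int[@lebesgueN R N]_(t in row_of_tuple @^-1` A) (f (row_of_tuple t))%:E)%E.

(* The library norm on 'rV_N is the sup norm; this is the Euclidean one. *)
Definition enorm x : R := Num.sqrt (\sum_(i < N) x 0 i ^+ 2).

Definition partial (i : 'I_N) f : 'rV[R]_N -> R :=
  fun x => 'D_(delta_mx 0 i) f x.

Definition gradient f : 'rV[R]_N -> 'rV[R]_N := fun x => \row_i partial i f x.

Definition laplacian f : 'rV[R]_N -> R :=
  fun x => \sum_(i < N) partial i (partial i f) x.

(* The derivatives of the library are total, so their existence has to be
   required in addition to continuity. *)
Definition smooth f := forall s : seq 'I_N,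
  let g := foldr partial f s in
  continuous g /\ forall (i : 'I_N) x, derivable g x (delta_mx 0 i).

(* Functions in C_0^oo(Omega) are taken extended by 0 to the whole of R^N. *)
Definition test_function Omega u :=
  [/\ smooth u, compact (closure [set x | u x != 0])
    & closure [set x | u x != 0] `<=` Omega].

Definition bounded_domain Omega :=
  [/\ open Omega, connected Omega, Omega !=set0 & bounded_set Omega].

End euclidean.

Section weights.
Context {R : realType}.

(* X1 0 = 1 here because ln 0 = 0 in the library; 0 is only reached at the
   origin, which is Lebesgue-null. *)
Definition X1 (t : R) : R := (1 - ln t)^-1.

(* X_k for k >= 1, with X_1 = X1 and X_k = X1 \o X_(k-1). *)
Definition Xk (k : nat) (t : R) : R := iter k X1 t.

Definition sigma (s N : R) : R :=
  ((N + 2 * s) * (N - 4 - 2 * s) / 4) ^+ 2.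

Definition sigmabar (s N : R) : R :=
  (1 + s) ^+ 2 + (N + 2 * s) * (N - 4 - 2 * s) / 8.

(* sum_(i >= 1) int_Omega f^2 / |x|^p * X_1^2 ... X_i^2 dx,
   with X_j = X_j(|x| / D) *)
Definition log_series (N : nat) (Omega : set 'rV[R]_N) (D : R)
    (f : 'rV[R]_N -> R) (p : nat) : \bar R :=
  (\sum_(1 <= i <oo) integral_rV Omega (fun x =>
     (f x ^+ 2 / enorm x ^+ p *
      \prod_(1 <= j < i.+1) Xk j (enorm x / D) ^+ 2)%R))%E.

End weights.

(* Main.v *)
Require Import Defs.
From mathcomp Require Import all_boot all_order all_algebra.
From mathcomp Require Import all_classical all_reals all_analysis.
From mathcomp Require Import measurable_realfun zify ring lra.
Import Order.TTheory GRing.Theory Num.Theory.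
Import numFieldNormedType.Exports.
Local Open Scope classical_set_scope.
Local Open Scope ring_scope.

(** Write [E u = x . grad u], [rho = |x|^2] and, for a weight [rho^-q] with
    [2 q < N], put [beta = (N - 2 q) / 2], [A = E u + beta u], [p = q - 1] and
    [P = rho Lap u - 2 p A + beta (beta + 2 p) u].  In the variables
    [t = - ln |x|], [u = |x|^-beta g] one has [A = - |x|^-beta g_t] and
    [P = |x|^-beta (g_tt + Delta_S g)], so that [A] and [P] are orthogonal in
    the weighted space: this is a Pohozaev identity and replaces the expansion
    in spherical harmonics.  It yields
    [int rho^-q (rho Lap u)^2 >= int rho^-q (c A^2 + B^2 u^2)] with
    [B = beta (beta + 2 p)] and [c = 4 p^2 + 2 B], and the logarithmic terms come
    from [int rho^-q A^2] by completing the square with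
    [phi = (1/2) sum_(j <= k) X_1 ... X_j], which satisfies
    [- (phi_t + phi^2) = (1/4) sum_(j <= k) X_1^2 ... X_j^2].

    All the identities say that the divergence of some field [F] has integral
    zero.  The fields are singular at the origin, but the origin misses almost
    every line parallel to an axis and the partial derivatives are
    [O(|x|^(-2 q))], hence integrable: Fubini and the fundamental theorem of
    calculus on lines suffice.  The theorem follows by iterating the weighted
    Rellich inequality, after one Hardy inequality for (ii). *)

Set Implicit Arguments.
Unset Strict Implicit.
Unset Printing Implicit Defensive.

(** * Integration over tuples, line by line *)

Section TupleMeasure.
Context {R : realType}.
Local Notation T := (measurableTypeR R).
Local Notation leb := (@lebesgue_measure R).

Lemma tnth_tcons0 n (p : T * n.-tuple T) : tnth (tcons p) ord0 = p.1.
Proof. by rewrite (tnth_nth 0). Qed.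

Lemma tnth_tconsS n (p : T * n.-tuple T) (j : 'I_n) :
  tnth (tcons p) (lift ord0 j) = tnth p.2 j.
Proof. by rewrite !(tnth_nth 0). Qed.

Definition tuple_update n (t : n.-tuple T) (i : 'I_n) (s : T) : n.-tuple T :=
  [tuple (if j == i then s else tnth t j) | j < n].

Lemma tuple_update_cons0 n (p : T * n.-tuple T) (s : T) :
  tuple_update (tcons p) ord0 s = tcons (s, p.2).
Proof.
apply: eq_from_tnth => j; rewrite tnth_mktuple.
by case: (unliftP ord0 j) => [k ->|->]; rewrite ?tnth_tconsS ?tnth_tcons0 ?eqxx.
Qed.

Lemma tuple_update_consS n (p : T * n.-tuple T) (i : 'I_n) (s : T) :
  tuple_update (tcons p) (lift ord0 i) s = tcons (p.1, tuple_update p.2 i s).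
Proof.
apply: eq_from_tnth => j; rewrite tnth_mktuple.
case: (unliftP ord0 j) => [k ->|->]; rewrite ?tnth_tconsS ?tnth_tcons0 ?eqxx//=.
by rewrite tnth_mktuple (inj_eq lift_inj).
Qed.

(** [lebesgueN n.+1] is by definition the pushforward of the product measure under [tcons], so this
    is a change of variables. Fubini is left to the caller, which needs both orders of
    integration. *)
Lemma integral_lebesgueNS n (f : n.+1.-tuple T -> \bar R) :
  (@lebesgueN R n.+1).-integrable setT f ->
  (leb \x @lebesgueN R n)%E.-integrable setT (f \o @tcons R n) /\
  (\int[@lebesgueN R n.+1]_t f t =
   \int[(leb \x @lebesgueN R n)%E]_p f (tcons p))%E.
Proof.
move=> intf.
have mf := measurable_int _ intf.
have If : (leb \x @lebesgueN R n)%E.-integrable setT (f \o @tcons R n).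
  apply/integrableP; split.
    by apply: measurableT_comp => //; exact: measurable_tcons.
  move/integrableP : intf => [_].
  rewrite [X in (X < _)%E -> _](_ : _ = \int[pushforward (leb \x @lebesgueN R n)%E (@tcons R n)]_y `|f y|)%E//.
  rewrite ge0_integral_pushforward//.
  - exact: measurable_tcons.
  - exact: measurableT_comp.
split=> //.
rewrite [LHS](_ : _ = \int[pushforward (leb \x @lebesgueN R n)%E (@tcons R n)]_y f y)%E//.
by rewrite integral_pushforward//; exact: measurable_tcons.
Qed.

Lemma ge0_integral_lebesgueNS n (f : n.+1.-tuple T -> \bar R) :
  measurable_fun setT f -> (forall t, 0 <= f t)%E ->
  (\int[@lebesgueN R n.+1]_t f t =
   \int[leb]_x \int[@lebesgueN R n]_y f (tcons (x, y)))%E.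
Proof.
move=> mf f0.
rewrite [LHS](_ : _ = \int[pushforward (leb \x @lebesgueN R n)%E (@tcons R n)]_y f y)%E//.
rewrite ge0_integral_pushforward//; last exact: measurable_tcons.
rewrite preimage_setT fubini_tonelli1//=.
by apply: measurableT_comp => //; exact: measurable_tcons.
Qed.

(** Through [tcons] the hyperplane becomes a product with a null factor: the point [0] for the first
    coordinate, a lower-dimensional hyperplane otherwise. *)
Lemma lebesgueN_tnth_eq0 n (i : 'I_n) :
  @lebesgueN R n [set t | tnth t i = 0] = 0%E.
Proof.
elim: n i => [[]//|n IH i].
rewrite [LHS](_ : _ = (leb \x @lebesgueN R n)%E
  (@tcons R n @^-1` [set t | tnth t i = 0]))//.
have m0 k (j : 'I_k) : measurable [set t : k.-tuple T | tnth t j = 0].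
  rewrite [X in measurable X](_ : _ = setT `&` (fun t => tnth t j) @^-1` [set 0]).
    exact: measurable_tnth.
  by rewrite setTI.
case: (unliftP ord0 i) => [j ->|->].
- rewrite (_ : _ @^-1` _ = [set: T] `*` [set t | tnth t j = 0]); last first.
    by apply/seteqP; split=> [p|p []] /=; rewrite tnth_tconsS.
  rewrite product_measure1E; [|exact: measurableT|exact: m0].
  by apply/eqP; rewrite mule_eq0; apply/orP; right; apply/eqP; exact: IH.
- rewrite (_ : _ @^-1` _ = [set (0 : T)] `*` [set: n.-tuple T]); last first.
    by apply/seteqP; split=> [p|p []] /=; rewrite tnth_tcons0.
  rewrite product_measure1E; [|exact: measurable_set1|exact: measurableT].
  apply/eqP; rewrite mule_eq0; apply/orP; left; apply/eqP.
  exact: lebesgue_measure_set1.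
Qed.

#[global] Instance lebesgueN_ae_filter n :
  Filter (almost_everywhere (@lebesgueN R n)).
Proof. exact: (@ae_filter_ringOfSetsType _ _ _ (@lebesgueN R n)). Qed.

Lemma ae_tnth_neq0 n :
  {ae @lebesgueN R n, forall t, forall i : 'I_n, tnth t i != 0}.
Proof.
(* The finite intersection is taken over all [k : nat], to apply [ae_foralln]; values [k >= n] are
   vacuous. *)
have : {ae @lebesgueN R n, forall t, forall k : nat, forall i : 'I_n,
    nat_of_ord i = k -> tnth t i != 0}.
  apply: ae_foralln => k.
  have [kn|kn] := ltnP k n; last first.
    by apply: aeW => t i ik; move: kn; rewrite -ik leqNgt ltn_ord.
  exists [set t | tnth t (Ordinal kn) = 0]; split.
  - rewrite [X in measurable X](_ : _ = setT `&` (fun t => tnth t (Ordinal kn)) @^-1` [set 0]).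
      exact: measurable_tnth.
    by rewrite setTI.
  - exact: lebesgueN_tnth_eq0.
  - move=> t /=; apply: contra_notP => /eqP tk i ik.
    by rewrite (_ : i = Ordinal kn)//; exact: val_inj.
by apply: filterS => t H i; exact: H.
Qed.

(** Fubini with the [i]-th coordinate innermost; the induction peels off the first coordinate until
    it is the chosen one. Lines contained in a hyperplane [t_j = 0] with [j != i] form a null set
    and are exempt; when [n > 1] this discards every line through the origin. *)
Lemma integral_eq0_of_lines n (i : 'I_n) (f : n.-tuple T -> \bar R) :
  (@lebesgueN R n).-integrable setT f ->
  (forall t, (forall j, j != i -> tnth t j != 0) ->
     (\int[leb]_s f (tuple_update t i s) = 0)%E) ->
  (\int[@lebesgueN R n]_t f t = 0)%E.
Proof.
elim: n i f => [[]//|n IH i f intf lines].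
have [intF ->] := integral_lebesgueNS intf.
case: (unliftP ord0 i) lines => [j ->|->] lines.
- rewrite -integral12_prod_meas1//.
  rewrite (@ae_eq_integral _ _ _ leb setT (cst 0%E))//.
  + by rewrite integral0.
  + exact: (measurable_fubini_F intF).
  + have ae0 : {ae leb, forall x : T, x != 0}.
      exists [set 0]; split=> //; first exact: lebesgue_measure_set1.
      by move=> x /=; apply: contra_notP => /eqP.
    have := ae_integrable1 intF.
    apply: filterS2 ae0 => x x0 intx _.
    apply: (IH j) => // t tj.
    have /= := lines (tcons (x, t)).
    under eq_integral do rewrite tuple_update_consS.
    apply=> k; case: (unliftP ord0 k) => [k' ->|->].
      by rewrite (inj_eq lift_inj) tnth_tconsS; exact: tj.
    by rewrite tnth_tcons0.
- rewrite -integral21_prod_meas1//.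
  rewrite (@ae_eq_integral _ _ _ (@lebesgueN R n) setT (cst 0%E))//.
  + by rewrite integral0.
  + exact: (measurable_fubini_G intF).
  + apply: filterS (ae_tnth_neq0 n) => t t0 _.
    (* The entry [0] is a placeholder, overwritten by [tuple_update]. *)
    have /= := lines (tcons (0, t)).
    under eq_integral do rewrite tuple_update_cons0.
    apply=> k; case: (unliftP ord0 k) => [k' ->|->].
      by rewrite tnth_tconsS.
    by rewrite eqxx.
Qed.

(** By Tonelli and induction, the integral of the product of the [|h (t_i)|] is the product of
    finite one-variable integrals. *)
Lemma integrable_prod n (h : T -> R) : leb.-integrable setT (EFin \o h) ->
  (@lebesgueN R n).-integrable setT (fun t => (\prod_(i < n) h (tnth t i))%:E).
Proof.
move=> inth.
have mh : measurable_fun setT h by apply/measurable_EFinP; exact: measurable_int inth.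
have mp k : measurable_fun setT (fun t : k.-tuple T => (\prod_(i < k) h (tnth t i))%:E).
  apply/measurable_EFinP; apply: measurable_prod => i _.
  by apply: measurableT_comp => //; exact: measurable_tnth.
elim: n => [|n IH].
  apply/integrableP; split; first exact: mp.
  under eq_integral do rewrite big_ord0 /= normr1.
  by rewrite integral_cst//= diracT mule1 ltry.
apply/integrableP; split; first exact: mp.
rewrite ge0_integral_lebesgueNS; [|by apply: measurableT_comp => //; exact: mp|by []].
have inner x : (\int[@lebesgueN R n]_y
      `|(\prod_(i < n.+1) h (tnth (tcons (x, y)) i))%:E| =
    `|(h x)%:E| * \int[@lebesgueN R n]_y `|(\prod_(i < n) h (tnth y i))%:E|)%E.
  rewrite -ge0_integralZl//; last by apply: measurableT_comp => //; exact: mp.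
  apply: eq_integral => y _.
  rewrite big_ord_recl tnth_tcons0/= normrM EFinM.
  by under eq_bigr do rewrite tnth_tconsS.
under eq_integral do rewrite inner.
rewrite ge0_integralZr//.
- apply: lte_mul_pinfty.
  + exact: integral_ge0.
  + rewrite ge0_fin_numE; first by move/integrableP : inth => [].
    exact: integral_ge0.
  + by move/integrableP : IH => [].
- apply/measurable_EFinP; exact: measurableT_comp.
- exact: integral_ge0.
Qed.

End TupleMeasure.

(** * Integrability of negative powers of the norm *)

Section OneDim.
Context {R : realType}.
Local Notation T := (measurableTypeR R).
Local Notation leb := (@lebesgue_measure R).

Lemma integral_powR_near0 (c a A : R) : 0 < c -> 0 < a -> a < A ->
  (\int[leb]_(x in `[a, A]) (x `^ (c - 1))%:E =
   (A `^ c / c - a `^ c / c)%:E)%E.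
Proof.
move=> c0 a0 aA.
have dp (e y : R) : 0 < y -> derivable (@powR R ^~ e) y 1.
  by move=> y0; apply: derivable_powR; rewrite in_itv/= andbT.
have cp (e y : R) : 0 < y -> {for y, continuous (@powR R ^~ e)}.
  by move=> y0; apply/differentiable_continuous/derivable1_diffP; exact: dp.
have cF y : 0 < y -> {for y, continuous (fun x : R => x `^ c / c)}.
  by move=> y0; apply: cvgM; [exact: cp|exact: cvg_cst].
rewrite (@continuous_FTC2 _ (fun x => x `^ (c - 1)) (fun x => x `^ c / c) a A)//.
- apply: derivable_within_continuous => x; rewrite in_itv/= => /andP[ax _].
  by apply: dp; exact: lt_le_trans ax.
- split=> [x||].
  + rewrite in_itv/= => /andP[ax _].
    by apply: derivableM => //; apply: dp; exact: lt_trans ax.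
  + by apply: cvg_at_right_filter; exact: cF.
  + by apply: cvg_at_left_filter; apply: cF; exact: lt_trans aA.
- move=> x; rewrite in_itv/= => /andP[ax _].
  have x0 : 0 < x by exact: lt_trans ax.
  rewrite derive1E deriveM//; last exact: dp.
  rewrite derive_cst scaler0 add0r -derive1E powR_derive1 ?in_itv/= ?andbT//.
  by rewrite [_ *: _]mulrA mulVf ?mul1r// gt_eqF.
Qed.

(* The library has two convertible measurable structures on [R], which
   unification does not identify. *)
Lemma measurable_fun_toT (D : set R) (f : R -> R) :
  measurable_fun D f -> measurable_fun (D : set T) (f : T -> R).
Proof. exact id. Qed.

(** One factor of the product that dominates [|x|^(- 2 q)], to be used with [c - 1 = - 2 q / N]; the
    cut at [A] fits functions vanishing off a box. *)
Definition cut_powR (c A x : R) : R := if `|x| <= A then `|x| `^ (c - 1) else 0.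

Lemma measurable_cut_powR (c A : R) : measurable_fun setT (cut_powR c A : T -> R).
Proof.
apply: (@measurable_fun_toT setT).
have mn := @normr_measurable R setT.
apply: measurable_fun_ifT => //; first exact: measurable_fun_ler.
exact: (measurableT_comp (@measurable_powR R (c - 1)) mn).
Qed.

Lemma cut_powR_ge0 (c A x : R) : 0 <= cut_powR c A x.
Proof. by rewrite /cut_powR; case: ifP => // _; exact: powR_ge0. Qed.

(** The exponent [c - 1] exceeds [-1], so the singularity at [0] is integrable. The positive
    half-line is treated by monotone convergence, the negative one by reflection. *)
Lemma integrable_cut_powR (c A : R) : 0 < c -> 1 < A ->
  leb.-integrable setT (EFin \o cut_powR c A).
Proof.
move=> c0 A1.
have A0 : 0 < A by exact: lt_trans A1.
have mE D : measurable_fun D (EFin \o cut_powR c A : T -> _).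
  by apply/measurable_EFinP; apply: measurable_funTS; exact: measurable_cut_powR.
have h0 x : (0 <= (EFin \o cut_powR c A) x)%E by rewrite lee_fin cut_powR_ge0.
have half : (\int[leb]_(x in `[0%R, +oo[) (cut_powR c A x)%:E < +oo)%E.
  have -> : (\int[leb]_(x in `[0%R, +oo[) (cut_powR c A x)%:E =
      \int[leb]_(x in `[0%R, A]) (x `^ (c - 1))%:E)%E.
    rewrite [in RHS]integral_mkcond [in LHS]integral_mkcond.
    apply: eq_integral => x _; rewrite /cut_powR !patchE.
    have [x0|x0] := leP 0 x; last first.
      by rewrite !memNset//= in_itv/= leNgt x0.
    rewrite mem_set/= ?in_itv/= ?x0// ger0_norm//.
    have [xA|xA] := leP x A; first by rewrite mem_set//= in_itv/= x0.
    by rewrite memNset//= in_itv/= x0/= leNgt xA.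
  have mp D : measurable_fun D (fun x : T => (x `^ (c - 1))%:E).
    by apply/measurable_EFinP; apply: measurable_funTS; exact: measurable_powR.
  rewrite -integral_itv_obnd_cbnd; last exact: mp.
  (* These intervals exhaust []0, A]] and the integral over each is at most [A^c / c]; [1 < A]
     ensures that their left ends stay below [A]. *)
  pose F (n : nat) : set T := `[n.+1%:R^-1, A]%classic.
  have FE : `]0, A]%classic = \bigcup_n F n.
    apply/seteqP; split=> x /=.
      rewrite in_itv/= => /andP[x0 xA].
      have [k [_ kx]] : exists k, True /\ x^-1 < k.+1%:R.
        by exists (Num.truncn x^-1); split=> //; exact: Num.Theory.truncnS_gt.
      exists k => //=; rewrite /F/= in_itv/= xA andbT.
      by rewrite -[x]invrK lef_pV2 ?posrE ?invr_gt0// ltW.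
    move=> [k _]; rewrite /F/= !in_itv/= => /andP[kx ->]; rewrite andbT.
    by apply: lt_le_trans kx; rewrite invr_gt0.
  have ndF : nondecreasing_seq F.
    apply/nondecreasing_seqP => n; apply/subsetPset => x; rewrite /F/= !in_itv/=.
    move=> /andP[nx ->]; rewrite andbT (le_trans _ nx)//.
    by rewrite lef_pV2 ?posrE// ler_nat.
  have mF n : measurable (F n) by exact: measurable_itv.
  have fF n x : F n x -> (0 <= (x `^ (c - 1))%:E)%E.
    by move=> _; rewrite lee_fin powR_ge0.
  have lim := @ge0_nondecreasing_set_cvg_integral _ T R F
    (fun x : T => (x `^ (c - 1))%:E) leb ndF mF (fun n => mp (F n)) fF.
  rewrite FE.
  apply: (@le_lt_trans _ _ (A `^ c / c)%:E); last by rewrite ltry.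
  rewrite -(cvg_lim _ lim)//.
  apply: lime_le; first exact: cvgP lim.
  apply: nearW => n /=.
  rewrite integral_powR_near0// ?lee_fin.
  - by rewrite gerBl divr_ge0// ?powR_ge0// ltW.
  - by rewrite (le_lt_trans _ A1)// invf_le1// ler1n.
apply/integrableP; split; first exact: mE.
under eq_integral do rewrite gee0_abs//.
rewrite (_ : [set: R] = `[0, +oo[%classic `|` `]-oo, 0[%classic); last first.
  by apply/esym/seteqP; split=> // x _ /=; rewrite !in_itv/= andbT; case: (leP 0 x); [left|right].
rewrite ge0_integral_setU//; last first.
  apply/disj_set2P/seteqP; split=> x //= [].
  by rewrite !in_itv/= andbT leNgt => /negP.
rewrite lte_add_pinfty//.
apply: le_lt_trans half.
rewrite ge0_integration_by_substitution0//; last exact: mE.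
rewrite [leRHS](_ : _ = \int[leb]_(x in `]-oo, 0%R]) (cut_powR c A x)%:E)%E; last first.
  by apply: eq_integral => x _; rewrite /cut_powR normrN.
apply: ge0_subset_integral => //.
by move=> x /=; rewrite !in_itv/=; exact: ltW.
Qed.

End OneDim.

(** * Measurability of functions continuous off the origin *)

Section RowMeasurability.
Context {R : realType} {N : nat}.
Local Notation T := (measurableTypeR R).
Local Notation V := 'rV[R]_N.
Local Notation row := (@row_of_tuple R N).
Local Notation mu := (@lebesgueN R N).
Local Notation mtup := (@measurable _ (N.-tuple T)).
Implicit Types (x : V) (f : V -> R).

(** The sigma-algebra on tuples is generated by the coordinates and the norm on rows is the sup
    norm, so an open set is a countable union of measurable boxes with rational centres. *)
Lemma measurable_row_open (O : set V) : open O -> mtup (row @^-1` O).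
Proof.
move=> oO.
pose box (ck : {ffun 'I_N -> rat} * nat) : set (N.-tuple T) :=
  \big[setI/setT]_(i < N) [set t | `|tnth t i - ratr (ck.1 i)| < ck.2.+1%:R^-1].
pose good ck := box ck `<=` row @^-1` O.
rewrite (_ : _ @^-1` _ = \bigcup_(ck in [set ck | good ck]) box ck).
  (* Boxes that leave [O] are replaced by the empty set, so that the union runs over a whole
     countable type. *)
  rewrite [X in mtup X](_ : _ =
      \bigcup_ck (if `[< good ck >] then box ck else set0)); last first.
    apply/seteqP; split=> t /= [ck].
      by move=> gck bt; exists ck => //; case: asboolP.
    by move=> _; case: asboolP => // gck bt; exists ck.
  apply: countable_bigcupT_measurable => [|ck]; first exact: countableP.
  case: ifP => // _.
  apply: bigsetI_measurable => i _.
  rewrite [X in mtup X](_ : _ = [set: N.-tuple T] `&`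
    (fun t : N.-tuple T => tnth t i) @^-1`
      (ball (ratr (ck.1 i) : R) ck.2.+1%:R^-1 : set T)).
    by apply: (measurable_tnth i) => //; exact: measurable_ball.
  by rewrite setTI; apply/seteqP; split=> t /=; rewrite -ball_normE/= distrC.
have boxP ck t : box ck t <-> forall i, `|tnth t i - ratr (ck.1 i)| < ck.2.+1%:R^-1.
  rewrite /box -bigcap_seq; split=> [H i|H i _]; last exact: H.
  by apply: H; rewrite /= mem_index_enum.
apply/seteqP; split=> t /=; last by move=> [ck gck /gck].
move=> Ot; have /nbhs_ballP[e /= e0 eO] : nbhs (row t) O by exact: open_nbhs_nbhs.
(* Two points of a box of half-side [1 / (k + 1)] differ by less than [2 / (k + 1)] in each
   coordinate. *)
have [k ke] : exists k : nat, 2 / k.+1%:R < e.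
  exists (Num.truncn (2 / e)).
  rewrite ltr_pdivrMr// mulrC -ltr_pdivrMr//; exact: Num.Theory.truncnS_gt.
have [c cP] : exists c : {ffun 'I_N -> rat},
    forall i, `|tnth t i - ratr (c i)| < k.+1%:R^-1.
  have H i : exists r : rat, `|tnth t i - ratr r| < k.+1%:R^-1.
    have k0 : 0 < k.+1%:R^-1 :> R by rewrite invr_gt0.
    have /rat_in_itvoo[r] : tnth t i - k.+1%:R^-1 < tnth t i + k.+1%:R^-1 :> R.
      by rewrite ltrD2l (lt_trans _ k0)// oppr_lt0.
    rewrite in_itv/= => /andP[r1 r2]; exists r.
    by rewrite ltr_distlC r1.
  have [g gP] := choice H.
  by exists (finfun g) => i; rewrite ffunE.
exists (c, k); last exact/boxP.
move=> s /boxP/= sc; apply: eO; split=> // i j; rewrite !mxE -ball_normE/=.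
rewrite (le_lt_trans (ler_distD (ratr (c j)) _ _))//.
rewrite (lt_trans _ ke)// (_ : 2 / _ = k.+1%:R^-1 + k.+1%:R^-1); last by ring.
by rewrite ltrD// distrC.
Qed.

Lemma open_neq0 : open [set x : V | x != 0].
Proof.
rewrite (_ : [set _ | _] = ~` [set 0]).
  by apply: closed_openC; apply: accessible_closed_set1; exact/hausdorff_accessible/norm_hausdorff.
by apply/seteqP; split=> y /= /eqP.
Qed.

Lemma measurable_row_cont f : (forall x, x != 0 -> {for x, continuous f}) ->
  measurable_fun setT (f \o row : N.-tuple T -> R).
Proof.
move=> cf _; apply: (measurability _ (RGenOInfty.measurableE R)) => //.
move=> /= _ [_ [a ->] <-]; rewrite setTI preimage_itvoy.
pose O : set V := [set x | x != 0 /\ a < f x].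
have oO : open O.
  rewrite openE => x [x0 ax]; rewrite /interior.
  have c1 := cf x x0.
  have : \forall y \near x, y != 0 /\ a < f y.
    near=> y; split.
    - by near: y; apply: open_nbhs_nbhs; split=> //; exact: open_neq0.
    - by near: y; exact: (cvgr_gt _ c1).
  by [].
have o0 := open_neq0.
(* A superlevel set is the open set [O], with the origin added when [a < f 0]. *)
have [a0|a0] := ltP a (f 0).
  rewrite (_ : [set _ | _] = row @^-1` O `|` ~` (row @^-1` [set x | x != 0])).
    apply: measurableU; first exact: measurable_row_open.
    by apply: measurableC; exact: measurable_row_open.
  apply/seteqP; split=> t /=.
    by have [->|t0] := eqVneq (row t) 0; [right; apply/negP; rewrite negbK|left].
  by case=> [[]//|/negP]; rewrite negbK => /eqP ->.
rewrite (_ : [set _ | _] = row @^-1` O); first exact: measurable_row_open.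
apply/seteqP; split=> t /=; last by case.
by move=> at_; split=> //; apply/eqP => t0; move: at_; rewrite /= t0 ltNge a0.
Unshelve. all: by end_near. Qed.

End RowMeasurability.

(** * The squared Euclidean norm *)

Section SquaredNorm.
Context {R : realType} {N : nat}.
Local Notation V := 'rV[R]_N.
Implicit Types x : V.

(** The [rho] of the overview: being polynomial, it turns even powers of the norm into rational
    functions of the coordinates. *)
Definition sqnorm x : R := \sum_(i < N) x 0 i ^+ 2.

Lemma sqnorm_ge0 x : 0 <= sqnorm x.
Proof. by apply: sumr_ge0 => i _; exact: sqr_ge0. Qed.

Lemma sqr_coord_le x i : x 0 i ^+ 2 <= sqnorm x.
Proof.
by rewrite /sqnorm (bigD1 i)//= lerDl; apply: sumr_ge0 => j _; exact: sqr_ge0.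
Qed.

Lemma sqnorm_eq0 x : (sqnorm x == 0) = (x == 0).
Proof.
apply/eqP/eqP => [x0|->]; last first.
  by rewrite /sqnorm big1// => i _; rewrite mxE expr0n.
apply/rowP => i; rewrite mxE; apply/eqP; rewrite -sqrf_eq0.
by rewrite eq_le sqr_ge0 -x0 sqr_coord_le.
Qed.

Lemma sqnorm_gt0 x : (0 < sqnorm x) = (x != 0).
Proof. by rewrite lt_neqAle sqnorm_ge0 andbT eq_sym sqnorm_eq0. Qed.

Lemma enorm_sqnorm x : enorm x ^+ 2 = sqnorm x.
Proof. by rewrite /enorm sqr_sqrtr// sqnorm_ge0. Qed.

Lemma enorm_ge0 x : 0 <= enorm x. Proof. exact: sqrtr_ge0. Qed.

Lemma enorm_gt0 x : (0 < enorm x) = (x != 0).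
Proof. by rewrite /enorm sqrtr_gt0 sqnorm_gt0. Qed.

End SquaredNorm.

(** * Fields with a singularity at the origin *)

Section Divergence.
Context {R : realType} {N : nat}.
Local Notation T := (measurableTypeR R).
Local Notation V := 'rV[R]_N.
Local Notation row := (@row_of_tuple R N).
Local Notation mu := (@lebesgueN R N).
Local Notation leb := (@lebesgue_measure R).
Local Notation e i := (delta_mx 0 i : V).
Implicit Types (x : V) (f : V -> R).

Definition vanishes_off_box (A : R) f := forall x i, A < `|x 0 i| -> f x = 0.

(* [|x_i| <= |x|] for each [i], hence [|x|^(-2 q) <= prod_i |x_i|^(- 2 q / N)]. *)
Lemma integrable_row_bound f (q : nat) (A C : R) : (2 * q < N)%N -> 1 < A ->
  (forall x, x != 0 -> {for x, continuous f}) ->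
  (forall x, x != 0 -> `|f x| <= C * sqnorm x ^- q) ->
  vanishes_off_box A f ->
  mu.-integrable setT (EFin \o (f \o row)).
Proof.
move=> qN A1 cf fC fA.
have N0 : 0 < N%:R :> R by rewrite ltr0n (leq_ltn_trans _ qN).
pose r : R := q%:R / N%:R.
pose c : R := 1 - 2 * r.
have c0 : 0 < c.
  rewrite /c /r subr_gt0 mulrA ltr_pdivrMr// mul1r.
  by rewrite -natrM ltr_nat.
have r0 : 0 <= r by rewrite divr_ge0.
have inth := integrable_prod N (integrable_cut_powR c0 A1).
have mf : measurable_fun setT (EFin \o (f \o row)).
  by apply/measurable_EFinP; exact: measurable_row_cont.
have intP := integrableZl measurableT `|C| inth.
apply/integrableP; split=> //.
have /integrableP[mP] := intP.
apply: le_lt_trans.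
apply: ae_ge0_le_integral => //.
- exact: measurableT_comp.
- exact: measurableT_comp.
apply: filterS (ae_tnth_neq0 N) => t t0 _ /=.
rewrite lee_fin normrM normr_id.
have [[i Ai]|nA] := pselect (exists i, A < `|row t 0 i|).
  by rewrite (fA _ i)// normr0 mulr_ge0.
have tA i : `|tnth t i : R| <= A.
  by rewrite leNgt; apply/negP => ti; apply: nA; exists i; rewrite mxE.
have rt0 : row t != 0.
  have [i _] : exists i : 'I_N, true.
    by case: N N0 {qN} => [|n] //; rewrite ?ltxx// => _; exists ord0.
  by apply/eqP => /rowP/(_ i); rewrite !mxE => /eqP; rewrite (negbTE (t0 i)).
apply: (le_trans (fC _ rt0)).
apply: (@le_trans _ _ (`|C| * sqnorm (row t) ^- q)).
  by rewrite ler_wpM2r ?ler_norm// invr_ge0 exprn_ge0// sqnorm_ge0.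
rewrite ler_wpM2l//.
rewrite ger0_norm; last by apply: prodr_ge0 => i _; exact: cut_powR_ge0.
have s0 : 0 < sqnorm (row t) by rewrite sqnorm_gt0.
have -> : sqnorm (row t) ^- q = \prod_(i < N) (sqnorm (row t) `^ (- r)).
  rewrite big_const_ord iter_mulr_1 -[RHS]powR_mulrn ?powR_ge0// -powRrM.
  by rewrite /r mulNr -mulrA mulVf ?gt_eqF// mulr1 powR_invn// ltW.
apply: ler_prod => i _; rewrite powR_ge0/= /cut_powR tA.
have ti : 0 < `|tnth t i : R| by rewrite normr_gt0; exact: t0.
rewrite (_ : c - 1 = 2%:R * (- r)); last by rewrite /c; ring.
rewrite powRrM powR_mulrn ?(ltW ti)// !powRN lef_pV2 ?posrE ?powR_gt0 ?exprn_gt0//.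
apply: ge0_ler_powR; rewrite ?nnegrE ?exprn_ge0 ?(ltW s0)//.
by rewrite real_normK ?num_real//; have := sqr_coord_le (row t) i; rewrite mxE.
Qed.

Lemma row_tuple_update t i s : row (tuple_update t i s) = s *: e i + row (tuple_update t i 0).
Proof.
apply/rowP => j; rewrite !mxE !tnth_mktuple eqxx/= eq_sym.
by case: eqVneq => _; rewrite ?mulr1 ?addr0// mulr0 add0r.
Qed.

Lemma line_integral_derive0 (A : R) (g dg : R -> R) : 0 < A ->
  (forall s : R, is_derive s (1 : R) g (dg s)) -> continuous dg ->
  (forall s, A < `|s| -> g s = 0) -> (forall s, A < `|s| -> dg s = 0) ->
  (\int[leb]_s (dg s)%:E = 0)%E.
Proof.
move=> A0 gdg cdg gA dgA.
have dg1 (s : R) : derivable g s 1 by have [] := gdg s.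
have cg : continuous g by move=> s; apply/differentiable_continuous/derivable1_diffP.
(* The interval is enlarged by 1 because [gA] gives [g s = 0] only for [|s|] strictly above [A]. *)
transitivity (\int[leb]_(s in `[(- (A + 1))%R, (A + 1)%R]) (dg s)%:E)%E.
  rewrite [RHS]integral_mkcond; apply: eq_integral => s _; rewrite patchE.
  case: ifPn => //; rewrite notin_setE/= in_itv/= -ler_norml => /negP.
  by rewrite -ltNge => As; rewrite dgA// (lt_trans _ As)// ltrDl.
have AA : - (A + 1) < A + 1 by lra.
rewrite (@continuous_FTC2 _ dg g)//.
- have AA1 : A < `|A + 1| by rewrite ger0_norm ?ltrDl// addr_ge0// ltW.
  by rewrite !gA ?subee// normrN.
- exact: continuous_subspaceT.
- split.
  + by move=> s _.
  + by apply: cvg_at_right_filter; exact: cg.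
  + by apply: cvg_at_left_filter; exact: cg.
- by move=> s _; rewrite derive1E; have [] := gdg s.
Qed.

(** One component of the divergence theorem for a field singular at the origin. The bound on [dF]
    gives integrability by [integrable_row_bound]; then the integral along each admissible line
    vanishes by the fundamental theorem of calculus. *)
Lemma integral_partial_eq0 (i : 'I_N) (F dF : V -> R) (q : nat) (A C : R) :
  (1 < N)%N -> (2 * q < N)%N -> 1 < A ->
  (forall x, x != 0 -> is_derive x (e i) F (dF x)) ->
  (forall x, x != 0 -> {for x, continuous dF}) ->
  (forall x, x != 0 -> `|dF x| <= C * sqnorm x ^- q) ->
  vanishes_off_box A F -> vanishes_off_box A dF ->
  mu.-integrable setT (EFin \o (dF \o row)) /\
  (\int[mu]_t (dF (row t))%:E = 0)%E.
Proof.
move=> N1 qN A1 dFP cdF dFC FA dFA.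
have intdF := integrable_row_bound qN A1 cdF dFC dFA.
split=> //.
apply: (integral_eq0_of_lines (i := i) intdF) => t tj /=.
(* As [1 < N], there is a coordinate [j] other than [i]; [tj] makes it nonzero along the whole line,
   which thus misses the origin. *)
have row0 s : row (tuple_update t i s) != 0.
  have [j ji] : exists j, j != i.
    have [i0|i0] := eqVneq (val i) 0%N.
      by exists (Ordinal N1); apply/eqP => /(congr1 val)/=; rewrite i0.
    by exists (Ordinal (ltnW N1)); apply: contra i0 => /eqP <-.
  apply/eqP => /rowP/(_ j); rewrite !mxE tnth_mktuple (negbTE ji) => /eqP.
  by rewrite (negbTE (tj j ji)).
have A0 : 0 < A by exact: lt_trans A1.
apply: (@line_integral_derive0 A (fun s => F (row (tuple_update t i s)))) => //.
- move=> s; have [dF1 dF2] := dFP _ (row0 s).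
  have E : (fun h : R => h^-1 *: (F (row (tuple_update t i (h *: (1 : R) + s))) - F (row (tuple_update t i s)))) =
           (fun h : R => h^-1 *: (F (h *: e i + row (tuple_update t i s)) - F (row (tuple_update t i s)))).
    apply/funext => h; congr (_ *: (F _ - _)).
    rewrite row_tuple_update [in RHS]row_tuple_update scalerDl addrA.
    by rewrite [_ *: (1 : R)]mulr1.
  by split; rewrite /derivable /derive /shift/= ?E.
- move=> s; apply: (@continuous_comp _ _ _ (fun s => row (tuple_update t i s)) dF); last exact: cdF.
  rewrite (_ : (fun _ => _) = (fun s => s *: e i + row (tuple_update t i 0))); last first.
    by apply/funext => r; exact: row_tuple_update.
  by apply: cvgD; [apply: cvgZr_tmp; exact: cvg_id|exact: cvg_cst].
- by move=> s sA; apply: (FA _ i); rewrite mxE tnth_mktuple eqxx.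
- by move=> s sA; apply: (dFA _ i); rewrite mxE tnth_mktuple eqxx.
Qed.

End Divergence.

(** * Functions of class C^1 *)

Section Calculus.
Context {R : realType} {N : nat}.
Local Notation V := 'rV[R]_N.
Local Notation e i := (delta_mx 0 i : V).
Implicit Types (x : V) (f g : V -> R) (K : set V).

Definition C1 f := continuous f /\
  forall i, (forall x, derivable f x (e i)) /\ continuous (partial i f).

Lemma C1_cont f x : C1 f -> {for x, continuous f}.
Proof. by case=> cf _; exact: cf. Qed.

Lemma C1_derivable f i x : C1 f -> derivable f x (e i).
Proof. by case=> _ /(_ i)[]. Qed.

Lemma C1_pcont f i x : C1 f -> {for x, continuous (partial i f)}.
Proof. by case=> _ /(_ i)[_ cf]; exact: cf. Qed.

Lemma C1_is_derive f i x : C1 f -> is_derive x (e i) f (partial i f x).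
Proof. by case=> _ /(_ i)[df _]; apply: derivableP. Qed.

Lemma partialD f g i : C1 f -> C1 g ->
  partial i (f \+ g) = partial i f \+ partial i g.
Proof.
move=> [_ /(_ i)[df _]] [_ /(_ i)[dg _]].
by apply/funext => x; rewrite /partial deriveD.
Qed.

Lemma partialM f g i : C1 f -> C1 g ->
  partial i (f \* g) = (f \* partial i g) \+ (partial i f \* g).
Proof.
move=> [_ /(_ i)[df _]] [_ /(_ i)[dg _]].
by apply/funext => x; rewrite /partial deriveM//; congr (_ + _); exact: mulrC.
Qed.

Lemma C1D f g : C1 f -> C1 g -> C1 (f \+ g).
Proof.
move=> Cf Cg; split=> [x|i]; first by apply: continuousD; exact: C1_cont.
rewrite partialD//; split=> x; first by apply: derivableD; exact: C1_derivable.
by apply: continuousD; exact: C1_pcont.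
Qed.

Lemma C1M f g : C1 f -> C1 g -> C1 (f \* g).
Proof.
move=> Cf Cg; split=> [x|i]; first by apply: continuousM; exact: C1_cont.
rewrite partialM//; split=> x; first by apply: derivableM; exact: C1_derivable.
by apply: continuousD; apply: continuousM; [exact: C1_cont|exact: C1_pcont|exact: C1_pcont|exact: C1_cont].
Qed.

Lemma partial_cst (a : R) i : partial i (cst a : V -> R) = cst 0.
Proof. by apply/funext => x; rewrite /partial derive_cst. Qed.

Lemma C1_cst (a : R) : C1 (cst a : V -> R).
Proof.
split=> [|i]; first exact: cst_continuous.
by rewrite partial_cst; split=> [x|]; [exact: derivable_cst|exact: cst_continuous].
Qed.

Lemma is_derive_coord (i j : 'I_N) x :
  is_derive x (e i) (fun y : V => y 0 j) (i == j)%:R.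
Proof.
have E : (fun h : R => h^-1 *: ((h *: e i + x) 0 j - x 0 j)) @ 0^' --> ((i == j)%:R : R).
  apply: (@cvg_trans _ ((fun=> (i == j)%:R : R) @ 0^')); last exact: cvg_cst.
  apply: near_eq_cvg; near=> h; rewrite !mxE eqxx/= addrK eq_sym.
  rewrite [RHS]mulrA mulVf ?mul1r//; near: h; exact: nbhs_dnbhs_neq.
by apply: DeriveDef; [apply/cvg_ex; exists (i == j)%:R|exact: cvg_lim].
Unshelve. all: by end_near. Qed.

Lemma partial_coord i j : partial i (fun y : V => y 0 j) = cst (i == j)%:R.
Proof. by apply/funext => x; have [_] := is_derive_coord i j x. Qed.

Lemma C1_coord j : C1 (fun y : V => y 0 j).
Proof.
split=> [|i]; first exact: coord_continuous.
rewrite partial_coord; split=> [x|]; last exact: cst_continuous.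
by have [] := is_derive_coord i j x.
Qed.

Lemma C1_sum n (f : 'I_n -> V -> R) : (forall k, C1 (f k)) ->
  C1 (fun x => \sum_(k < n) f k x) /\
  forall i x, partial i (fun x => \sum_(k < n) f k x) x = \sum_(k < n) partial i (f k) x.
Proof.
elim: n f => [|n IH] f Cf.
  have -> : (fun x : V => \sum_(k < 0) f k x) = cst 0.
    by apply/funext => x; rewrite big_ord0.
  by split=> [|i x]; [exact: C1_cst|rewrite partial_cst big_ord0].
have -> : (fun x : V => \sum_(k < n.+1) f k x) =
    f ord0 \+ (fun x => \sum_(k < n) f (lift ord0 k) x).
  by apply/funext => x; rewrite big_ord_recl.
have [IH1 IH2] := IH (fun k => f (lift ord0 k)) (fun k => Cf _).
split=> [|i x]; first exact: C1D.
by rewrite partialD//= IH2 big_ord_recl.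
Qed.

Lemma smooth_partial f i : smooth f -> smooth (partial i f).
Proof. by move=> sf s; rewrite -foldr_rcons; exact: sf. Qed.

Lemma smooth_C1 f : smooth f -> C1 f.
Proof.
move=> sf; split=> [|i]; first by have [] := sf [::].
by split=> [x|]; [have [_ /(_ i x)] := sf [::]|have [] := sf [:: i]].
Qed.

Lemma foldr_partialD f g s : smooth f -> smooth g ->
  foldr partial (f \+ g) s = foldr partial f s \+ foldr partial g s.
Proof.
move=> sf sg; elim: s => //= i s ->.
have sm h : smooth h -> smooth (foldr partial h s).
  move=> sh t; rewrite -foldr_cat; exact: sh.
by rewrite partialD//; apply: smooth_C1; exact: sm.
Qed.

Lemma smoothD f g : smooth f -> smooth g -> smooth (f \+ g).
Proof.
move=> sf sg s /=; rewrite foldr_partialD//.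
have [cf df] := sf s; have [cg dg] := sg s.
split=> [x|i x]; first by apply: continuousD; [exact: cf|exact: cg].
by apply: derivableD; [exact: df|exact: dg].
Qed.

Lemma smooth0 : smooth (cst 0 : V -> R).
Proof.
move=> s /=; rewrite (_ : foldr _ _ _ = cst 0).
  by split=> [|i x]; [exact: cst_continuous|exact: derivable_cst].
by elim: s => //= i s ->; rewrite partial_cst.
Qed.

Lemma smooth_laplacian f : smooth f -> smooth (laplacian f).
Proof.
move=> sf; rewrite /laplacian.
elim: (index_enum _) => [|i s IH].
  rewrite (_ : (fun _ => _) = cst 0); first exact: smooth0.
  by apply/funext => x; rewrite big_nil.
rewrite (_ : (fun _ => _) = partial i (partial i f) \+
    (fun x => \sum_(i <- s) partial i (partial i f) x)); last first.
  by apply/funext => x; rewrite big_cons.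
exact: (smoothD (smooth_partial i (smooth_partial i sf)) IH).
Qed.

Definition supported K f := forall x, ~ K x -> f x = 0.

Lemma supported_near K f x : closed K -> supported K f -> ~ K x ->
  \forall y \near x, f y = 0.
Proof.
move=> cK fK nKx; have : nbhs x (~` K).
  by apply: open_nbhs_nbhs; split=> //; exact: closed_openC.
by apply: filterS => y; exact: fK.
Qed.

Lemma supported_partial K f i : closed K -> supported K f ->
  supported K (partial i f).
Proof.
move=> cK fK x nKx; rewrite /partial (@near_eq_derive _ _ _ _ (cst 0)).
- by rewrite derive_cst.
- exact: supported_near nKx.
Qed.

Lemma supported_laplacian K f : closed K -> supported K f ->
  supported K (laplacian f).
Proof.
move=> cK fK x nKx; rewrite /laplacian big1// => i _.
by rewrite (supported_partial i cK (supported_partial i cK fK)).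
Qed.

Lemma is_derive_line f i x (s : R) : (forall y, derivable f y (e i)) ->
  is_derive s (1 : R) (fun r : R => f (r *: e i + x)) (partial i f (s *: e i + x)).
Proof.
move=> df; have := df (s *: e i + x); rewrite /partial.
have E : (fun h : R => h^-1 *: (f ((h *: (1 : R) + s) *: e i + x) - f (s *: e i + x))) =
         (fun h : R => h^-1 *: (f (h *: e i + (s *: e i + x)) - f (s *: e i + x))).
  by apply/funext => h; rewrite scalerDl addrA [_ *: (1 : R)]mulr1.
by move=> dfs; split; rewrite /derivable /derive /shift/= E.
Qed.

Lemma partial_mvt f i x (h : R) : C1 f -> 0 < h ->
  exists2 s, 0 < s < h & f (h *: e i + x) - f x = partial i f (s *: e i + x) * h.
Proof.
move=> [_ Cf] h0; have [df _] := Cf i.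
have dl s := is_derive_line x s df.
have [|s sh] := MVT h0 (fun s _ => dl s).
  apply: derivable_within_continuous => r _.
  by have [] := dl r.
rewrite scale0r add0r subr0 => E; exists s => //.
Qed.

Lemma subr4C (a b c d : R) : a - b - (c - d) = a - c - (b - d).
Proof. by ring. Qed.

Lemma dist_halves (a b c eps : R) :
  `|a - c| < eps / 2 -> `|b - c| < eps / 2 -> `|a - b| <= eps.
Proof.
move=> ac bc; rewrite (le_trans (ler_distD c _ _))// [X in _ + X]distrC.
by lra.
Qed.

(** The mean value theorem twice: in direction [i] for the increment [k] of [f] along [e j], then in
    direction [j] for [partial i f]. *)
Lemma second_difference f i j x (h : R) : C1 f -> C1 (partial i f) -> 0 < h ->
  exists s r, [/\ 0 < s < h, 0 < r < h &
   f (h *: e i + (h *: e j + x)) - f (h *: e j + x) - (f (h *: e i + x) - f x) =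
   partial j (partial i f) (r *: e j + (s *: e i + x)) * h * h].
Proof.
move=> Cf Cif h0.
pose k (y : V) := f (h *: e j + y) - f y.
have dk y : is_derive y (e i) k (partial i f (h *: e j + y) - partial i f y).
  apply: is_deriveB; last exact: C1_is_derive.
  have [d1 d2] := C1_is_derive i (h *: e j + y) Cf.
  have E : (fun t : R => t^-1 *: (f (h *: e j + (t *: e i + y)) - f (h *: e j + y))) =
     (fun t : R => t^-1 *: (f (t *: e i + (h *: e j + y)) - f (h *: e j + y))).
    by apply/funext => t; rewrite addrCA.
  by split; rewrite /derivable /derive /shift/= E.
have Ek : partial i k = fun y => partial i f (h *: e j + y) - partial i f y.
  by apply/funext => y; have [] := dk y.
have [s sh Es] : exists2 s, 0 < s < h &
    k (h *: e i + x) - k x = partial i k (s *: e i + x) * h.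
  have dl s := @is_derive_line k i x s (fun y => @ex_derive _ _ _ _ _ _ _ (dk y)).
  have [|s sh] := MVT h0 (fun s _ => dl s).
    apply: derivable_within_continuous => r _.
    by have [] := dl r.
  rewrite scale0r add0r subr0 => E; exists s => //.
have [r rh Er] := partial_mvt j (s *: e i + x) Cif h0.
exists s, r; split=> //.
rewrite -Er -[partial i f _ - _]/((fun y => partial i f (h *: e j + y) - partial i f y) (s *: e i + x)).
rewrite -Ek -Es /k (addrCA (h *: e j)).
exact: subr4C.
Qed.

(** Schwarz's theorem: the second difference is symmetric in [i] and [j], so the two mixed
    derivatives agree at points arbitrarily close to [x], and continuity carries this to [x]. *)
Lemma partialC f i j x : C1 f -> C1 (partial i f) -> C1 (partial j f) ->
  partial i (partial j f) x = partial j (partial i f) x.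
Proof.
move=> Cf Ci Cj.
have lim k l g : {for x, continuous g} -> forall eps : R, 0 < eps ->
    exists2 d : R, 0 < d & forall s r, 0 < s < d -> 0 < r < d ->
      `|g x - g (r *: e k + (s *: e l + x))| < eps.
  move=> cg eps eps0.
  have /cvgrPdist_lt/(_ _ eps0)/nbhs_ballP[d /= d0 dg] := cg.
  (* In the sup norm the displacement along [e k] and [e l] is at most [r + s], also when [k = l];
     hence the half. *)
  exists (d / 2); first by rewrite divr_gt0.
  move=> s r /andP[s0 sd] /andP[r0 rd]; apply: dg; split=> // a b.
  rewrite -ball_normE/= !mxE.
  have b01 (c : bool) (t : R) : 0 < t -> `|t * c%:R| <= t.
    by move=> t0; case: c; rewrite ?mulr1 ?mulr0 ?normr0 ?gtr0_norm// ltW.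
  rewrite (_ : _ - _ = - (r * ((a == 0) && (b == k))%:R + s * ((a == 0) && (b == l))%:R)); last by ring.
  rewrite normrN (le_lt_trans (ler_normD _ _))//.
  by rewrite (le_lt_trans (lerD (b01 _ _ r0) (b01 _ _ s0)))//; lra.
apply/eqP; rewrite -subr_eq0 -normr_le0; apply/ler_addgt0Pr => eps eps0.
have eps2 : 0 < eps / 2 by rewrite divr_gt0.
have [d1 d10 H1] := lim i j _ (@C1_pcont (partial j f) i x Cj) _ eps2.
have [d2 d20 H2] := lim j i _ (@C1_pcont (partial i f) j x Ci) _ eps2.
have [h [h0 hd1 hd2]] : exists h, [/\ 0 < h, h <= d1 & h <= d2].
  by exists (Num.min d1 d2); rewrite lt_min d10 d20 !ge_min !lexx orbT.
have [s [r [sh rh Esr]]] := second_difference j x Cf Ci h0.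
have [s' [r' [sh' rh' Esr']]] := second_difference i x Cf Cj h0.
have E : partial j (partial i f) (r *: e j + (s *: e i + x)) =
         partial i (partial j f) (r' *: e i + (s' *: e j + x)).
  apply: (@mulIf _ h); first by rewrite gt_eqF.
  apply: (@mulIf _ h); first by rewrite gt_eqF.
  apply: (etrans (esym Esr)); apply: etrans Esr'.
  by rewrite [in LHS]addrCA; exact: subr4C.
have lt1 t : 0 < t < h -> 0 < t < d1 by move=> /andP[-> /lt_le_trans] ->.
have lt2 t : 0 < t < h -> 0 < t < d2 by move=> /andP[-> /lt_le_trans] ->.
have A := H1 _ _ (lt1 _ sh') (lt1 _ rh').
have B := H2 _ _ (lt2 _ sh) (lt2 _ rh).
rewrite E in B; rewrite add0r; exact: dist_halves A B.
Qed.

Lemma vanishing_bounded f (A : R) : continuous f -> vanishes_off_box A f ->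
  exists2 C, 0 <= C & forall x, `|f x| <= C.
Proof.
move=> cf fA.
have cB : compact [set x : V | forall i, `[- A, A]%classic (x ord0 i)].
  apply: (@rV_compact R N (fun=> `[- A, A]%classic)) => _.
  exact: segment_compact.
have := compact_bounded (continuous_compact (continuous_subspaceT cf) cB).
(* [compact_bounded] yields a bound by every real strictly above [M], of which [|M| + 1] is one. *)
move=> [M [Mr MB]]; exists (`|M| + 1); first by rewrite addr_ge0.
move=> x; have [xA|] := pselect (forall i, `|x 0 i| <= A).
  apply: (MB (`|M| + 1)); first by rewrite (le_lt_trans (ler_norm _))// ltrDl.
  by exists x => // i /=; rewrite in_itv/= -ler_norml.
move=> /existsNP[i /negP]; rewrite -ltNge => Ax.
by rewrite (fA _ _ Ax) normr0 addr_ge0.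
Qed.

End Calculus.

(** * Functions of integral zero, as a vector space *)

Section ZeroIntegral.
Context {R : realType} {N : nat}.
Local Notation V := 'rV[R]_N.
Local Notation row := (@row_of_tuple R N).
Local Notation mu := (@lebesgueN R N).
Implicit Types (x : V) (f g : V -> R).

Definition row_integrable f := mu.-integrable setT (EFin \o (f \o row)).

(** Integrability is bundled so that divergence identities can be added and scaled without side
    conditions. *)
Definition zero_integral f := row_integrable f /\ (\int[mu]_t (f (row t))%:E = 0)%E.

Lemma eq_zero_integral f g : f =1 g -> zero_integral f -> zero_integral g.
Proof. by move=> /funext ->. Qed.

Lemma row_integrableD f g : row_integrable f -> row_integrable g -> row_integrable (fun x => f x + g x).
Proof. by move=> If Ig; exact: (integrableD measurableT If Ig). Qed.

Lemma row_integrableZ f (k : R) : row_integrable f -> row_integrable (fun x => k * f x).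
Proof. by move=> If; exact: (integrableZl measurableT k If). Qed.

Lemma zero_integralD f g : zero_integral f -> zero_integral g -> zero_integral (fun x => f x + g x).
Proof.
move=> [If f0] [Ig g0]; split; first exact: row_integrableD.
under eq_integral do rewrite EFinD.
by rewrite (integralD measurableT If Ig) /= f0 g0 adde0.
Qed.

Lemma zero_integralZ f (k : R) : zero_integral f -> zero_integral (fun x => k * f x).
Proof.
move=> [If f0]; split; first exact: row_integrableZ.
under eq_integral do rewrite EFinM.
by rewrite (integralZl measurableT If) /= f0 mule0.
Qed.

Lemma zero_integral0 : zero_integral (fun _ => 0).
Proof. by split; [exact: integrable0|exact: integral0]. Qed.

Lemma zero_integral_sum n (f : 'I_n -> V -> R) : (forall i, zero_integral (f i)) ->
  zero_integral (fun x => \sum_(i < n) f i x).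
Proof.
move=> Zf; elim: (index_enum _) => [|i s IH].
  by apply: (eq_zero_integral _ zero_integral0) => x; rewrite big_nil.
by apply: (eq_zero_integral _ (zero_integralD (Zf i) IH)) => x; rewrite big_cons.
Qed.

(** Both truncated inequalities are obtained this way: a suitable combination [h] of divergences
    makes the comparison pointwise. *)
Lemma zero_integral_le f g h : row_integrable f -> row_integrable g -> zero_integral h ->
  (forall x, g x + h x <= f x) ->
  (\int[mu]_t (g (row t))%:E <= \int[mu]_t (f (row t))%:E)%E.
Proof.
move=> If Ig [Ih h0] ghf.
rewrite -[leLHS]adde0 -h0 -(integralD measurableT Ig Ih).
apply: (le_integral measurableT (row_integrableD Ig Ih) If) => t _.
by rewrite /= lee_fin.
Qed.

End ZeroIntegral.

(** * Derivatives of radial weights *)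

Section RadialFields.
Context {R : realType} {N : nat}.
Local Notation V := 'rV[R]_N.
Local Notation e i := (delta_mx 0 i : V).
Implicit Types (x : V) (f g G psi kappa : V -> R).

Lemma is_derive_cast (U : normedModType R) (f : U -> R) (y v : U) (a b : R) :
  is_derive y v f a -> a = b -> is_derive y v f b.
Proof. by move=> H <-. Qed.

(** The directional derivative is that of the restriction [s |-> f (s *: v + x)] at [0], to which
    the one-variable chain rule applies. *)
Lemma is_derive_comp (h : R -> R) f x (v : V) (dh df : R) :
  is_derive (f x) (1 : R) h dh -> is_derive x v f df ->
  is_derive x v (fun y => h (f y)) (dh * df).
Proof.
move=> hd [fd1 fd2].
have E k : (fun r : R => r^-1 *: (k (r *: v + x) - k x)) =
    (fun r : R => r^-1 *: ((fun s : R => k (s *: v + x)) (r *: (1 : R) + 0)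
                         - (fun s : R => k (s *: v + x)) 0)) :> (R -> R).
  by apply/funext => r; rewrite addr0 scale0r add0r [_ *: (1 : R)]mulr1.
have fl : is_derive (0 : R) (1 : R) (fun s : R => f (s *: v + x)) df.
  by split; rewrite /derivable /derive /shift/= -?E.
have hd' : is_derive (f (0 *: v + x)) (1 : R) h dh by rewrite scale0r add0r.
have [c1 c2] := is_derive1_comp hd' fl.
have E' := E (fun y => h (f y)).
by split; rewrite /derivable /derive /shift/= E'.
Qed.

Lemma is_derive_sqnorm i x : is_derive x (e i) sqnorm (2 * x 0 i).
Proof.
have C j : C1 ((fun y : V => y 0 j) \* (fun y : V => y 0 j)).
  by apply: C1M; exact: C1_coord.
have [Cs Ps] := C1_sum C.
have := C1_is_derive i x Cs; rewrite Ps.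
rewrite (_ : (fun y : V => _) = sqnorm); last first.
  by apply/funext => y; apply: eq_bigr => j _; rewrite expr2.
move=> H; apply: is_derive_cast H _; rewrite (bigD1 i)//= big1 => [|j ji].
  rewrite partialM ?partial_coord/=; [|exact: C1_coord|exact: C1_coord].
  by rewrite eqxx mulr1 mul1r addr0 mulr_natl mulr2n.
rewrite partialM ?partial_coord/=; [|exact: C1_coord|exact: C1_coord].
by rewrite eq_sym (negbTE ji) mulr0 mul0r addr0.
Qed.

Lemma continuous_sqnorm : continuous (@sqnorm R N).
Proof.
have C j : C1 ((fun y : V => y 0 j) \* (fun y : V => y 0 j)).
  by apply: C1M; exact: C1_coord.
have [[Cs _] _] := C1_sum C.
by rewrite (_ : sqnorm = (fun x => \sum_(k < N) ((fun y : V => y 0 k) \* (fun y : V => y 0 k)) x)).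
Qed.

(* For [psi] a function of [|x|], [kappa] is the slope of [psi] as a function of
   [|x|^2 / 2]. *)
Definition radial_at (psi kappa : V -> R) x :=
  [/\ forall i, is_derive x (e i) psi (kappa x * x 0 i),
      {for x, continuous psi} & {for x, continuous kappa}].

Lemma radial_atM psi kappa psi' kappa' x :
  radial_at psi kappa x -> radial_at psi' kappa' x ->
  radial_at (fun y => psi y * psi' y)
    (fun y => kappa y * psi' y + psi y * kappa' y) x.
Proof.
move=> [d1 c1 k1] [d2 c2 k2]; split.
- move=> i.
  have H : is_derive x (e i) (fun y => psi y * psi' y) _ := is_deriveM (d1 i) (d2 i).
  apply: (is_derive_cast H).
  by rewrite -[_ *: _]/(psi x * _) -[X in _ + X]/(psi' x * _); ring.
- exact: continuousM.
- by apply: continuousD; exact: continuousM.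
Qed.

Lemma radial_at_comp (h dh : R -> R) psi kappa x :
  is_derive (psi x) (1 : R) h (dh (psi x)) -> {for psi x, continuous dh} ->
  radial_at psi kappa x ->
  radial_at (fun y => h (psi y)) (fun y => dh (psi y) * kappa y) x.
Proof.
move=> hd cdh [d1 c1 k1]; split.
- by move=> i; rewrite -mulrA; exact: is_derive_comp.
- apply: continuous_comp => //.
  by apply/differentiable_continuous/derivable1_diffP; have [] := hd.
- by apply: continuousM => //; exact: continuous_comp.
Qed.

Lemma radial_at_sqnorm x : radial_at sqnorm (cst 2) x.
Proof.
split; [by move=> i; exact: is_derive_sqnorm|exact: continuous_sqnorm|].
exact: cst_continuous.
Qed.

Lemma radial_at_pow (q : nat) x : x != 0 ->
  radial_at (fun y => sqnorm y ^- q)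
    (fun y => - (2 * q%:R) * sqnorm y ^- q.+1) x.
Proof.
move=> x0; have s0 : 0 < sqnorm x by rewrite sqnorm_gt0.
have sn0 : sqnorm x != 0 by rewrite gt_eqF.
have dpow (r : R) : r != 0 ->
    is_derive r (1 : R) (fun t : R => t ^- q) (- q%:R * r ^- q.+1).
  move=> r0; have dX : is_derive r (1 : R) (fun t : R => t ^+ q) (q%:R * r ^+ q.-1).
    apply: DeriveDef; first exact: exprn_derivable.
    by rewrite exp_derive [_ *: (1 : R)]mulr1.
  have rq0 : r ^+ q != 0 by rewrite expf_neq0.
  have H := @is_deriveV R (fun t => t ^+ q) r _ 1 rq0 dX.
  apply: (is_derive_cast H); rewrite [LHS]mulrA.
  case: q {dX rq0 H} => [|q]; first by rewrite !mulr0n mulr0 oppr0 !mul0r.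
  by rewrite /= !exprS; field; rewrite r0 expf_neq0.
have := @radial_at_comp (fun t : R => t ^- q) (fun t => - q%:R * t ^- q.+1) sqnorm (cst 2) x.
move=> /(_ (dpow _ sn0)) H.
have {}H := H _ (radial_at_sqnorm x).
rewrite (_ : (fun y => - (2 * q%:R) * _) = (fun y : V => - q%:R * sqnorm y ^- q.+1 * cst 2 y)).
  apply: H; apply: continuousM; first exact: cst_continuous.
  apply: (@continuousV _ _ (fun t : R => t ^+ q.+1)); first by rewrite expf_neq0.
  exact: exprn_continuous.
by apply/funext => y /=; ring.
Qed.

End RadialFields.

(** * Divergence identities *)

Section Identities.
Context {R : realType} {N : nat}.
Local Notation V := 'rV[R]_N.
Local Notation e i := (delta_mx 0 i : V).
Implicit Types (x : V) (f g G psi kappa u : V -> R).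
Variables (Om K : set V) (A : R).
Hypotheses (A1 : 1 < A) (OmA : forall x, Om x -> forall i, `|x 0 i| <= A).
Hypotheses (cK : closed K) (KOm : K `<=` Om) (N1 : (1 < N)%N).

Lemma supported_box f : supported K f -> vanishes_off_box A f.
Proof.
move=> fK x i Ax; apply: fK => Kx.
by have := OmA (KOm Kx) i; rewrite leNgt Ax.
Qed.

(** The weight is controlled on [Om] only; at a point outside [Om], hence outside the closed set
    [K], the product vanishes in a neighbourhood. *)
Lemma supported_continuousM psi G x : x != 0 ->
  (Om x -> {for x, continuous psi}) -> {for x, continuous G} -> supported K G ->
  {for x, continuous (fun y => psi y * G y)}.
Proof.
move=> x0 cpsi cG GK; have [Omx|nOm] := pselect (Om x).
  by apply: continuousM => //; exact: cpsi.
have nK : ~ K x by move/KOm.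
have G0 : \forall y \near x, psi y * G y = 0.
  by apply: filterS (supported_near cK GK nK) => y ->; rewrite mulr0.
rewrite /prop_for /continuous_at [X in _ --> X](_ : _ = 0); last by rewrite GK// mulr0.
exact: cvg_near_cst G0.
Qed.

Lemma row_integrable_supported psi G (q : nat) C : (2 * q < N)%N ->
  (forall x, Om x -> x != 0 -> {for x, continuous psi}) ->
  continuous G -> supported K G ->
  (forall x, Om x -> x != 0 -> `|psi x * G x| <= C * sqnorm x ^- q) ->
  row_integrable (fun x => psi x * G x).
Proof.
move=> qN cpsi cG GK bC.
have fK : supported K (fun x => psi x * G x).
  by move=> x nK; rewrite GK// mulr0.
apply: (@integrable_row_bound R N _ q A `|C|) => //.
- move=> x x0; apply: supported_continuousM => //; first by move=> ?; exact: cpsi.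
  exact: cG.
- move=> x x0; have [Omx|nOm] := pselect (Om x).
    apply: (le_trans (bC _ Omx x0)).
    by rewrite ler_wpM2r ?ler_norm// invr_ge0 exprn_ge0// sqnorm_ge0.
  have nK : ~ K x by move/KOm.
  by rewrite fK// normr0 mulr_ge0// invr_ge0 exprn_ge0// sqnorm_ge0.
- exact: supported_box.
Qed.

(** [integral_partial_eq0] for [psi * G], with the product rule as derivative on [Om] and the zero
    function near any point outside. *)
Lemma radial_field psi kappa G i (q : nat) C : (2 * q < N)%N ->
  (forall x, Om x -> x != 0 -> radial_at psi kappa x) ->
  C1 G -> supported K G ->
  (forall x, Om x -> x != 0 ->
    `|kappa x * x 0 i * G x + psi x * partial i G x| <= C * sqnorm x ^- q) ->
  zero_integral (fun x => kappa x * (x 0 i * G x) + psi x * partial i G x).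
Proof.
move=> qN rad CG GK bC.
have pK : supported K (partial i G) by exact: supported_partial.
have xGK : supported K (fun x => x 0 i * G x).
  by move=> x nK; rewrite GK// mulr0.
have dK : supported K (fun x => kappa x * (x 0 i * G x) + psi x * partial i G x).
  by move=> x nK; rewrite xGK// pK// !mulr0 addr0.
have := @integral_partial_eq0 R N i (fun x => psi x * G x)
  (fun x => kappa x * (x 0 i * G x) + psi x * partial i G x) q A `|C| N1 qN A1.
apply.
- move=> x x0; have [Omx|nOm] := pselect (Om x).
    have [dpsi _ _] := rad x Omx x0.
    have H : is_derive x (e i) (fun y => psi y * G y) _ :=
      is_deriveM (dpsi i) (C1_is_derive i x CG).
    apply: (is_derive_cast H).
    by rewrite -[_ *: _]/(psi x * _) -[X in _ + X]/(G x * _); ring.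
  have nK : ~ K x by move/KOm.
  have E : \near x, cst 0 x = psi x * G x.
    by apply: filterS (supported_near cK GK nK) => y ->; rewrite mulr0.
  by rewrite dK//; apply: near_eq_is_derive E _; exact: is_derive_cst.
- move=> x x0; apply: continuousD; apply: supported_continuousM => //.
  + by move=> Omx; have [] := rad x Omx x0.
  + by apply: continuousM; [exact: coord_continuous|exact: C1_cont].
  + by move=> Omx; have [] := rad x Omx x0.
  + exact: C1_pcont.
- move=> x x0; have [Omx|nOm] := pselect (Om x).
    rewrite mulrA; apply: (le_trans (bC _ Omx x0)).
    by rewrite ler_wpM2r ?ler_norm// invr_ge0 exprn_ge0// sqnorm_ge0.
  have nK : ~ K x by move/KOm.
  by rewrite dK// normr0 mulr_ge0// invr_ge0 exprn_ge0// sqnorm_ge0.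
- by apply: supported_box => x nK; rewrite GK// mulr0.
- exact: supported_box.
Qed.

Lemma sqnorm_bounded x : Om x -> sqnorm x <= N%:R * A ^+ 2.
Proof.
move=> Omx; rewrite /sqnorm.
apply: (@le_trans _ _ (\sum_(i < N) A ^+ 2)).
  apply: ler_sum => i _; rewrite -[x 0 i ^+ 2]real_normK ?num_real//.
  by rewrite ler_sqr ?nnegrE ?OmA// ltW// (lt_trans _ A1).
by rewrite sumr_const card_ord mulr_natl.
Qed.

(** On a bounded set the weaker singularity is dominated by the stronger one, so that terms of
    different orders share one bound. *)
Lemma sqnorm_powS x (q : nat) : Om x -> x != 0 ->
  sqnorm x ^- q <= N%:R * A ^+ 2 * sqnorm x ^- q.+1.
Proof.
move=> Omx x0; have s0 : 0 < sqnorm x by rewrite sqnorm_gt0.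
rewrite [sqnorm x ^+ q.+1]exprS invfM mulrA -[leLHS]mul1r.
rewrite ler_wpM2r ?invr_ge0 ?exprn_ge0 ?(ltW s0)//.
by rewrite ler_pdivlMr// mul1r sqnorm_bounded.
Qed.

Definition euler u x := \sum_(j < N) x 0 j * partial j u x.
Definition gradsq u x := \sum_(j < N) partial j u x * partial j u x.

Variable u : V -> R.
Hypotheses (su : smooth u) (uK : supported K u).

Let Cu : C1 u. Proof. exact: smooth_C1. Qed.
Let Cpu i : C1 (partial i u). Proof. exact/smooth_C1/smooth_partial. Qed.

Lemma C1_euler : C1 (euler u) /\
  forall i x, partial i (euler u) x =
    partial i u x + \sum_(j < N) x 0 j * partial i (partial j u) x.
Proof.
have C j : C1 ((fun x : V => x 0 j) \* partial j u).
  by apply: C1M; [exact: C1_coord|exact: Cpu].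
have [C1s P1s] := C1_sum C; split=> // i x.
rewrite P1s.
under eq_bigr => j _.
  rewrite partialM ?partial_coord/=; [|exact: C1_coord|exact: Cpu].
  over.
rewrite big_split/= addrC; congr (_ + _).
rewrite (bigD1 i)//= eqxx mul1r big1 ?addr0// => j ji.
by rewrite eq_sym (negbTE ji) mul0r.
Qed.

Lemma C1_gradsq : C1 (gradsq u) /\
  forall i x, partial i (gradsq u) x =
    2 * \sum_(j < N) partial j u x * partial i (partial j u) x.
Proof.
have C j : C1 (partial j u \* partial j u) by apply: C1M; exact: Cpu.
have [C1s P1s] := C1_sum C; split=> // i x.
rewrite P1s mulr_sumr; apply: eq_bigr => j _.
rewrite partialM/=; [|exact: Cpu|exact: Cpu].
by rewrite [X in _ + X]mulrC mulr_natl mulr2n.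
Qed.

Lemma supported_euler : supported K (euler u).
Proof.
move=> x nK; rewrite /euler big1// => j _.
by rewrite (supported_partial j cK uK nK) mulr0.
Qed.

Lemma supported_gradsq : supported K (gradsq u).
Proof.
move=> x nK; rewrite /gradsq big1// => j _.
by rewrite (supported_partial j cK uK nK) mulr0.
Qed.

Lemma supported_bounded f : continuous f -> supported K f ->
  exists2 C, 0 <= C & forall x, `|f x| <= C.
Proof. by move=> cf fK; exact: (vanishing_bounded cf (supported_box fK)). Qed.

(* The divergence of [psi u^2 x]. *)
Lemma radial_usq psi kappa (q : nat) C : (2 * q < N)%N ->
  (forall x, Om x -> x != 0 -> radial_at psi kappa x) ->
  (forall x, Om x -> x != 0 -> `|psi x| <= C * sqnorm x ^- q) ->
  (forall x, Om x -> x != 0 -> `|kappa x| <= C * sqnorm x ^- q.+1) ->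
  zero_integral (fun x => (N%:R * psi x + kappa x * sqnorm x) * u x ^+ 2
                 + 2 * psi x * u x * euler u x).
Proof.
move=> qN rad bpsi bkap.
pose G i := (u \* u) \* (fun y : V => y 0 i).
have CG i : C1 (G i).
  exact: (C1M (C1M Cu Cu) (C1_coord i)).
have PG i x : partial i (G i) x = u x * u x + 2 * u x * partial i u x * x 0 i.
  rewrite (partialM _ (C1M Cu Cu) (C1_coord i)) partial_coord.
  rewrite (partialM _ Cu Cu)/= eqxx mulr1; move: (partial _ _ _) (x 0 i) => a b; ring.
have GK i : supported K (G i).
  by move=> x nK; rewrite /G/= uK// !mul0r.
have [C0 C00 bu] := supported_bounded Cu.1 uK.
have bP i : exists2 C, 0 <= C & forall x, `|partial i (G i) x| <= C.
  apply: supported_bounded; last exact: supported_partial.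
  by move=> x; exact: C1_pcont.
suff Z i : zero_integral (fun x => kappa x * (x 0 i * G i x) + psi x * partial i (G i) x).
  apply: (eq_zero_integral _ (zero_integral_sum Z)) => x.
  have S1 : \sum_(i < N) x 0 i * G i x = sqnorm x * u x ^+ 2.
    by rewrite mulr_suml; apply: eq_bigr => i _; rewrite /G/=; ring.
  have S2 : \sum_(i < N) partial i (G i) x = N%:R * u x ^+ 2 + 2 * u x * euler u x.
    under eq_bigr do rewrite PG -mulrA [partial _ _ _ * _]mulrC.
    by rewrite big_split/= sumr_const card_ord -mulr_sumr expr2 -[in RHS]mulr_natl [in LHS]mulr_natl ?mulr_natl.
  rewrite big_split/= -!mulr_sumr S1 S2.
  by move: (euler u x) => E; ring.
have [CP CP0 bCP] := bP i.
(* The extra order of singularity of [kappa] is absorbed by [x_i G_i = x_i^2 u^2], which is at most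
   [C0 ^+ 2 * sqnorm x]. *)
apply: (@radial_field psi kappa (G i) i q (`|C| * C0 ^+ 2 + `|C| * CP)) => //.
move=> x Omx x0; have s0 : 0 < sqnorm x by rewrite sqnorm_gt0.
apply: (le_trans (ler_normD _ _)); rewrite mulrDl; apply: lerD.
  rewrite -mulrA normrM.
  apply: (@le_trans _ _ (`|C| * sqnorm x ^- q.+1 * (C0 ^+ 2 * sqnorm x))).
    apply: ler_pM => //.
      apply: (le_trans (bkap _ Omx x0)); rewrite ler_wpM2r ?ler_norm//.
      by rewrite invr_ge0 exprn_ge0// ltW.
    rewrite /G/= mulrCA -expr2 -expr2 normrM ler_pM//.
      by rewrite normrX ler_sqr ?nnegrE.
    by rewrite ger0_norm ?sqr_ge0// sqr_coord_le.
  rewrite exprS invfM le_eqVlt; apply/orP; left; apply/eqP; field.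
  by rewrite ?expf_neq0 gt_eqF.
rewrite normrM mulrAC; apply: ler_pM => //.
apply: (le_trans (bpsi _ Omx x0)); rewrite ler_wpM2r ?ler_norm//.
by rewrite invr_ge0 exprn_ge0// ltW.
Qed.

(** The divergence of [|x|^(- 2 p) G]. The products [x_i G_i] are bounded by a constant only, so the
    derivatives are of order [|x|^(- 2 (p + 1))]; this is the source of the condition on [p]. *)
Lemma radial_pow_field (p : nat) (G : 'I_N -> V -> R) : (2 * p.+1 < N)%N ->
  (forall i, C1 (G i)) -> (forall i, supported K (G i)) ->
  zero_integral (fun x => - (2 * p%:R) * sqnorm x ^- p.+1 * (\sum_(i < N) x 0 i * G i x)
                 + sqnorm x ^- p * \sum_(i < N) partial i (G i) x).
Proof.
move=> pN CG GK.
suff Z i : zero_integral (fun x => - (2 * p%:R) * sqnorm x ^- p.+1 * (x 0 i * G i x)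
                          + sqnorm x ^- p * partial i (G i) x).
  by apply: (eq_zero_integral _ (zero_integral_sum Z)) => x; rewrite big_split/= -!mulr_sumr.
have [C _ bC] : exists2 C, 0 <= C & forall x, `|x 0 i * G i x| <= C.
  apply: (@supported_bounded (fun x : V => x 0 i * G i x)); last first.
    by move=> x nK; rewrite GK// mulr0.
  by move=> x; apply: continuousM; [exact: coord_continuous|exact: C1_cont].
have [D D0 bD] : exists2 C, 0 <= C & forall x, `|partial i (G i) x| <= C.
  apply: supported_bounded; last exact: supported_partial.
  by move=> x; exact: C1_pcont.
apply: (@radial_field (fun x : V => sqnorm x ^- p)
  (fun x => - (2 * p%:R) * sqnorm x ^- p.+1) (G i) i p.+1
  (2 * p%:R * C + N%:R * A ^+ 2 * D)) => //.
  by move=> x _; exact: radial_at_pow.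
move=> x Omx x0; have s0 : 0 < sqnorm x by rewrite sqnorm_gt0.
apply: (le_trans (ler_normD _ _)); rewrite [leRHS]mulrDl; apply: lerD.
  rewrite -mulrA normrM [X in X * _]normrM normrN.
  rewrite [`|2 * _|]ger0_norm ?mulr_ge0//.
  rewrite [`|_^-1|]ger0_norm ?invr_ge0 ?exprn_ge0 ?(ltW s0)//.
  by rewrite mulrAC ler_wpM2r ?invr_ge0 ?exprn_ge0 ?(ltW s0)// ler_wpM2l ?mulr_ge0.
rewrite normrM ger0_norm ?invr_ge0 ?exprn_ge0 ?(ltW s0)// mulrAC.
by apply: ler_pM; rewrite ?invr_ge0 ?exprn_ge0 ?(ltW s0)// sqnorm_powS.
Qed.

(* The divergence of [|x|^(- 2 p) u grad u]. *)
Lemma green_identity (p : nat) : (2 * p.+1 < N)%N ->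
  zero_integral (fun x => - (2 * p%:R) * sqnorm x ^- p.+1 * (u x * euler u x)
                 + sqnorm x ^- p * (gradsq u x + u x * laplacian u x)).
Proof.
move=> pN.
have CG i : C1 (u \* partial i u) := C1M Cu (Cpu i).
have GK i : supported K (u \* partial i u) by move=> x nK; rewrite /= uK// mul0r.
apply: eq_zero_integral (radial_pow_field pN CG GK) => x.
congr (_ * _ + _ * _).
  by rewrite mulr_sumr; apply: eq_bigr => i _; rewrite mulrCA.
rewrite /laplacian mulr_sumr -big_split/=; apply: eq_bigr => i _.
by rewrite partialM//= addrC.
Qed.

(* The divergence of [|x|^(- 2 p) (E u grad u - (1/2) |grad u|^2 x)]. *)
Lemma pohozaev_identity (p : nat) : (2 * p.+1 < N)%N ->
  zero_integral (fun x => - (2 * p%:R) * sqnorm x ^- p.+1 *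
                   (euler u x ^+ 2 - 2^-1 * sqnorm x * gradsq u x)
                 + sqnorm x ^- p *
                   (euler u x * laplacian u x + (1 - N%:R / 2) * gradsq u x)).
Proof.
move=> pN; have [CE PE] := C1_euler; have [CQ PQ] := C1_gradsq.
pose G i := (euler u \* partial i u) \+
  (cst (- 2^-1) \* (gradsq u \* (fun y : V => y 0 i))).
have C2 i : C1 (gradsq u \* (fun y : V => y 0 i)) := C1M CQ (C1_coord i).
have C3 i : C1 (cst (- 2^-1) \* (gradsq u \* (fun y : V => y 0 i))) :=
  C1M (C1_cst _) (C2 i).
have CG i : C1 (G i) := C1D (C1M CE (Cpu i)) (C3 i).
have GK i : supported K (G i).
  move=> x nK.
  by rewrite /G/= (supported_euler nK) (supported_gradsq nK) !mul0r mulr0 addr0.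
apply: eq_zero_integral (radial_pow_field pN CG GK) => x.
congr (_ * _ + _ * _).
  rewrite expr2 {2}/euler -mulrA [2^-1 * _]mulrC mulrAC /sqnorm.
  rewrite mulr_sumr -mulrA [X in _ - X]mulr_suml -sumrB; apply: eq_bigr => i _.
  by rewrite /G/=; move: (euler u x) (gradsq u x) (x 0 i) (partial i u x) => a b c d; ring.
have PG i : partial i (G i) x =
    euler u x * partial i (partial i u) x + partial i u x * partial i u x
    - 2^-1 * gradsq u x
    + (partial i u x * (\sum_(j < N) x 0 j * partial i (partial j u) x)
       - x 0 i * (\sum_(j < N) partial j u x * partial i (partial j u) x)).
  rewrite (partialD _ (C1M CE (Cpu i)) (C3 i))/=.
  rewrite (partialM _ CE (Cpu i))/= (partialM _ (C1_cst _) (C2 i))/=.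
  rewrite (partialM _ CQ (C1_coord i))/= partial_coord/= partial_cst/= eqxx.
  rewrite [true%:R](_ : _ = 1)//.
  rewrite PE PQ.
  move: (euler u x) (gradsq u x) (x 0 i) (partial i u x) (partial i (partial i u) x).
by move: (\sum_(j < N) _) (\sum_(j < N) _) => a b c d k l m; field.
have Sa : \sum_(i < N) euler u x * partial i (partial i u) x
    = euler u x * laplacian u x by rewrite -mulr_sumr.
have Sc : \sum_(i < N) 2^-1 * gradsq u x = N%:R * (2^-1 * gradsq u x).
  by rewrite sumr_const card_ord mulr_natl.
(* The terms with the full Hessian, one from [E u grad u] and one from [|grad u|^2 x], cancel by the
   symmetry of second derivatives; only the Laplacian remains. *)
have Sd : \sum_(i < N) partial i u x * (\sum_(j < N) x 0 j * partial i (partial j u) x)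
    = \sum_(i < N) x 0 i * (\sum_(j < N) partial j u x * partial i (partial j u) x).
  under eq_bigr do rewrite mulr_sumr.
  under [RHS]eq_bigr do rewrite mulr_sumr.
  rewrite exchange_big/=; apply: eq_bigr => i _; apply: eq_bigr => j _.
  by rewrite mulrCA (partialC x Cu (Cpu j) (Cpu i)).
rewrite (eq_bigr _ (fun i _ => PG i)) big_split/= !sumrB Sd subrr addr0.
rewrite Sc big_split/= Sa -[\sum_(i < N) _]/(gradsq u x).
by move: (euler u x) (gradsq u x) (laplacian u x) => a b c; field.
Qed.

End Identities.

(** * Logarithmic weights *)

Section LogWeights.
Context {R : realType}.

Lemma X1_gt0_le1 (t : R) : 0 < t <= 1 -> 0 < X1 t <= 1.
Proof.
move=> /andP[t0 t1]; have l0 := ln_le0 t1.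
have l1 : 1 <= 1 - ln t by rewrite lerDl oppr_ge0.
have l2 : 0 < 1 - ln t by exact: lt_le_trans l1.
by rewrite /X1 invr_gt0 l2 invf_le1.
Qed.

Lemma is_derive_X1 (t : R) : 0 < t <= 1 -> is_derive t (1 : R) X1 (X1 t ^+ 2 / t).
Proof.
move=> /andP[t0 t1]; have l0 := ln_le0 t1.
have l2 : 1 - ln t != 0 by rewrite gt_eqF// subr_gt0 (le_lt_trans l0).
have dl : is_derive t (1 : R) (fun s => 1 - ln s) (0 - t^-1).
  exact: (is_deriveB (is_derive_cst (1 : R) t (1 : R)) (is_derive1_ln t0)).
have H := @is_deriveV R (fun s => 1 - ln s) t _ 1 l2 dl.
apply: (is_derive_cast H); rewrite /X1 -[_ *: _]/(_ * _) sub0r.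
by rewrite mulrN mulNr opprK exprVn.
Qed.

Lemma Xk_gt0_le1 k (t : R) : 0 < t <= 1 -> 0 < Xk k t <= 1.
Proof. by move=> t01; elim: k => //= k IH; exact: X1_gt0_le1. Qed.

Fixpoint logprod (k : nat) (t : R) : R :=
  if k is k'.+1 then logprod k' t * Xk k t else 1.

Lemma logprodE k t : logprod k t = \prod_(1 <= j < k.+1) Xk j t.
Proof.
elim: k => [|k IH]; first by rewrite big_nil.
by rewrite big_nat_recr//= IH.
Qed.

(** [logsum] is [2 phi] in the notation of the overview, and [logsumsq] is the truncated logarithmic
    weight. *)
Definition logsum k t := \sum_(1 <= j < k.+1) logprod j t.
Definition logsumsq k t := \sum_(1 <= j < k.+1) logprod j t ^+ 2.

Lemma logsumS k t : logsum k.+1 t = logsum k t + logprod k.+1 t.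
Proof. by rewrite /logsum big_nat_recr. Qed.

Lemma logsumsqS k t : logsumsq k.+1 t = logsumsq k t + logprod k.+1 t ^+ 2.
Proof. by rewrite /logsumsq big_nat_recr. Qed.

Lemma logprod_ge0_le1 k t : 0 < t <= 1 -> 0 <= logprod k t <= 1.
Proof.
move=> t01; elim: k => [|k /andP[k0 k1]] /=; first by rewrite ler01 lexx.
have /andP[x0 x1] := Xk_gt0_le1 k.+1 t01.
by rewrite mulr_ge0 ?(ltW x0)//= mulr_ile1 ?(ltW x0).
Qed.

Lemma logsum_ge0_le k t : 0 < t <= 1 -> 0 <= logsum k t <= k%:R.
Proof.
move=> t01; elim: k => [|k IH]; first by rewrite /logsum big_nil lexx.
rewrite logsumS -natr1; have := logprod_ge0_le1 k.+1 t01; lra.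
Qed.

Lemma logsumsq_ge0_le k t : 0 < t <= 1 -> 0 <= logsumsq k t <= k%:R.
Proof.
move=> t01; elim: k => [|k IH]; first by rewrite /logsumsq big_nil lexx.
rewrite logsumsqS -natr1; have := logprod_ge0_le1 k.+1 t01; move: IH.
move: (logprod k.+1 t) (logsumsq k t) => a b /andP[b0 bk] /andP[a0 a1].
have a2 : a ^+ 2 <= 1 by rewrite expr_le1.
by have := sqr_ge0 a; lra.
Qed.

End LogWeights.

(** * Slopes of the logarithmic weights *)

Section RadialWeights.
Context {R : realType} {N : nat}.
Local Notation V := 'rV[R]_N.
Variable (D : R).
Implicit Types x : V.

Definition relnorm x := enorm x / D.

(* The slopes, in the sense of [radial_at], of [X_k], [X_1 ... X_k] and
   [sum_(j <= k) X_1 ... X_j]. *)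
Fixpoint slopeX (k : nat) x : R :=
  if k is k'.+1 then X1 (Xk k' (relnorm x)) ^+ 2 / Xk k' (relnorm x) * slopeX k' x
  else (2 * Num.sqrt (sqnorm x))^-1 / D * 2.

Fixpoint slope_logprod (k : nat) x : R :=
  if k is k'.+1 then slope_logprod k' x * Xk k (relnorm x) + logprod k' (relnorm x) * slopeX k x
  else 0.

Definition slope_logsum k x := \sum_(1 <= j < k.+1) slope_logprod j x.

Hypothesis D0 : 0 < D.

Lemma relnorm_gt0_le1 x : x != 0 -> enorm x <= D -> 0 < relnorm x <= 1.
Proof.
move=> x0 xD; rewrite /relnorm divr_gt0 ?enorm_gt0//=.
by rewrite ler_pdivrMr// mul1r.
Qed.

Lemma radial_at_Xk k x : x != 0 -> enorm x <= D ->
  radial_at (fun y : V => Xk k (relnorm y)) (slopeX k) x.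
Proof.
move=> x0 xD; have t01 := relnorm_gt0_le1 x0 xD.
have s0 : 0 < sqnorm x by rewrite sqnorm_gt0.
elim: k => [|k IH].
  have := @radial_at_comp R N (fun r => Num.sqrt r / D)
    (fun r => (2 * Num.sqrt r)^-1 / D) sqnorm (cst 2) x.
  apply; last exact: radial_at_sqnorm.
    have H : is_derive (sqnorm x) (1 : R) (fun r => Num.sqrt r * D^-1) _ :=
      is_deriveM (is_derive1_sqrt s0) (is_derive_cst D^-1 (sqnorm x) (1 : R)).
    apply: (is_derive_cast H).
    by rewrite -[_ *: _]/(_ * _) -[X in _ + X]/(_ * _) mulr0 add0r mulrC.
  apply: continuousM; last exact: cst_continuous.
  apply: (@continuousV _ _ (fun r : R => 2 * Num.sqrt r)).
    by rewrite mulf_neq0// gt_eqF// sqrtr_gt0.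
  by apply: continuousM; [exact: cst_continuous|exact: sqrt_continuous].
have Xk01 := Xk_gt0_le1 k t01; have /andP[X0 X1'] := Xk01.
have dX := is_derive_X1 Xk01.
have := @radial_at_comp R N X1 (fun r => X1 r ^+ 2 / r)
  (fun y : V => Xk k (relnorm y)) (slopeX k) x dX.
apply => //.
have cX : {for Xk k (relnorm x), continuous (@X1 R)}.
  by apply/differentiable_continuous/derivable1_diffP; have [] := dX.
apply: continuousM.
  apply: (@continuous_comp _ _ _ X1 (fun r : R => r ^+ 2)) => //.
  exact: exprn_continuous.
by apply: (@continuousV _ _ id); [rewrite gt_eqF|exact: cvg_id].
Qed.

(** A slope is [r^-1 d/dr] with [r = |x|], so for [k >= 1] this reads
    [r dX_k/dr = X_1 ... X_(k-1) X_k^2]. It follows by induction from [t X1'(t) = X1(t)^2]. *)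
Lemma slopeXE k x : x != 0 -> enorm x <= D ->
  slopeX k x = Xk k (relnorm x) * logprod k (relnorm x) / sqnorm x.
Proof.
move=> x0 xD; have t01 := relnorm_gt0_le1 x0 xD.
have s0 : 0 < enorm x by rewrite enorm_gt0.
elim: k => [|k IH] /=.
  rewrite mulr1 -enorm_sqnorm -[Num.sqrt _]/(Num.sqrt (enorm x ^+ 2)).
  rewrite sqrtr_sqr gtr0_norm// /relnorm.
  by field; rewrite !gt_eqF.
rewrite IH; have /andP[X0 _] := Xk_gt0_le1 k t01.
have n0 : sqnorm x != 0 by rewrite gt_eqF// sqnorm_gt0.
move: (X1 _) => e; move: (Xk k (relnorm x)) X0 (logprod _ _) (sqnorm x) n0 => a a0 b c c0.
by field; rewrite c0 gt_eqF.
Qed.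

Lemma radial_at_logprod k x : x != 0 -> enorm x <= D ->
  radial_at (fun y : V => logprod k (relnorm y)) (slope_logprod k) x.
Proof.
move=> x0 xD; elim: k => [|k IH].
  split; [|exact: cst_continuous|exact: cst_continuous].
  by move=> i; rewrite mul0r; exact: is_derive_cst.
exact: (radial_atM IH (radial_at_Xk k.+1 x0 xD)).
Qed.

Lemma radial_atD (psi kappa psi' kappa' : V -> R) x :
  radial_at psi kappa x -> radial_at psi' kappa' x ->
  radial_at (fun y => psi y + psi' y) (fun y => kappa y + kappa' y) x.
Proof.
move=> [d1 c1 k1] [d2 c2 k2]; split.
- by move=> i; rewrite mulrDl; exact: is_deriveD.
- exact: continuousD.
- exact: continuousD.
Qed.

Lemma radial_at_logsum k x : x != 0 -> enorm x <= D ->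
  radial_at (fun y : V => logsum k (relnorm y)) (slope_logsum k) x.
Proof.
move=> x0 xD; rewrite /slope_logsum /logsum; elim: k => [|k IH].
  under [X in radial_at X _ _]eq_fun do rewrite big_nil.
  under [X in radial_at _ X _]eq_fun do rewrite big_nil.
  split; [|exact: cst_continuous|exact: cst_continuous].
  by move=> i; rewrite mul0r; exact: is_derive_cst.
under [X in radial_at X _ _]eq_fun do rewrite big_nat_recr//=.
under [X in radial_at _ X _]eq_fun do rewrite big_nat_recr//=.
exact: (radial_atD IH (radial_at_logprod k.+1 x0 xD)).
Qed.

(** Logarithmic differentiation: by [slopeXE], the factor [X_j] contributes [X_1 ... X_j]. *)
Lemma slope_logprodE k x : x != 0 -> enorm x <= D ->
  slope_logprod k x = logprod k (relnorm x) * logsum k (relnorm x) / sqnorm x.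
Proof.
move=> x0 xD; elim: k => [|k IH].
  by rewrite /logsum big_nil/= mulr0 mul0r.
rewrite -[LHS]/(slope_logprod k x * Xk k.+1 (relnorm x) + logprod k (relnorm x) * slopeX k.+1 x).
rewrite IH slopeXE// logsumS.
rewrite -[logprod k.+1 _]/(logprod k (relnorm x) * Xk k.+1 (relnorm x)).
have n0 : sqnorm x != 0 by rewrite gt_eqF// sqnorm_gt0.
move: (Xk k.+1 (relnorm x)) (logprod k _) (logsum k _) (sqnorm x) n0 => a b c d d0.
by field.
Qed.

(** Summation by parts: if [S_j] are the partial sums of [P_j], then twice the sum of the [P_j S_j]
    is [S_k^2] plus the sum of the [P_j^2]. With [r d/dr = - d/dt] this is the Riccati identity for
    [phi] in the overview. *)
Lemma slope_logsumE k x : x != 0 -> enorm x <= D ->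
  slope_logsum k x = (logsum k (relnorm x) ^+ 2 + logsumsq k (relnorm x)) / 2 / sqnorm x.
Proof.
move=> x0 xD; rewrite /slope_logsum; elim: k => [|k IH].
  by rewrite /logsum /logsumsq !big_nil expr0n addr0 !mul0r.
rewrite big_nat_recr//= IH -[_ + _ * _]/(slope_logprod k.+1 x) slope_logprodE// logsumS logsumsqS.
have n0 : sqnorm x != 0 by rewrite gt_eqF// sqnorm_gt0.
move: (logprod k.+1 _) (logsum k _) (logsumsq k _) (sqnorm x) n0 => a b c d d0.
by field.
Qed.

End RadialWeights.

(** * Rellich and Hardy inequalities *)

Section Inequalities.
Context {R : realType} {N : nat}.
Local Notation V := 'rV[R]_N.
Local Notation row := (@row_of_tuple R N).
Local Notation mu := (@lebesgueN R N).
Implicit Types (x : V) (f g : V -> R).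
Variables (Om K : set V) (A : R).
Hypotheses (A1 : 1 < A) (OmA : forall x, Om x -> forall i, `|x 0 i| <= A).
Hypotheses (cK : closed K) (KOm : K `<=` Om) (N1 : (1 < N)%N).
Variable D : R.
Hypotheses (D0 : 0 < D) (OmD : forall x, Om x -> enorm x <= D).
Variable u : V -> R.
Hypotheses (su : smooth u) (uK : supported K u).

Let uOm x : ~ Om x -> u x = 0.
Proof. by move=> nO; apply: uK => /KOm. Qed.

(** Cauchy-Schwarz, from the nonnegative quadratic [|t x - grad u|^2] at its minimiser
    [t = E u / rho]. *)
Lemma euler_sq_le x : euler u x ^+ 2 <= sqnorm x * gradsq u x.
Proof.
have [x0|] := eqVneq (sqnorm x) 0.
  rewrite x0 mul0r /euler big1 ?expr0n// => j _.
  by move/eqP: x0; rewrite sqnorm_eq0 => /eqP ->; rewrite mxE mul0r.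
rewrite sqnorm_eq0 -sqnorm_gt0 => s0.
have H (t : R) : 0 <= sqnorm x * t ^+ 2 - 2 * t * euler u x + gradsq u x.
  rewrite (_ : _ + _ = \sum_(j < N) (x 0 j * t - partial j u x) ^+ 2).
    by apply: sumr_ge0 => j _; exact: sqr_ge0.
  rewrite /sqnorm /euler /gradsq mulr_suml mulr_sumr -sumrB -big_split/=.
  by apply: eq_bigr => j _; move: (x 0 j) (partial j u x) => a b; ring.
have := H (euler u x / sqnorm x).
move: (euler u x) (sqnorm x) s0 (gradsq u x) => a s s0 g {}H.
suff : 0 <= (s * g - a ^+ 2) / s by rewrite pmulr_lge0 ?invr_gt0// subr_ge0.
by apply: le_trans H _; rewrite le_eqVlt; apply/orP; left; apply/eqP; field; rewrite gt_eqF.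
Qed.

(* The divergence of [|x|^(- 2 q) u^2 x]. *)
Lemma radial_hardy (q : nat) : (2 * q < N)%N ->
  zero_integral (fun x => sqnorm x ^- q * ((N%:R - 2 * q%:R) * u x ^+ 2 + 2 * u x * euler u x)).
Proof.
move=> qN.
have Z := @radial_usq R N Om K A A1 OmA cK KOm N1 u su uK (fun x => sqnorm x ^- q)
  (fun x => - (2 * q%:R) * sqnorm x ^- q.+1) q (1 + 2 * q%:R) qN.
have q2 : 0 <= 2 * q%:R :> R by rewrite mulr_ge0.
apply: eq_zero_integral (Z _ _ _) => [x|x Omx x0|x Omx x0|x Omx x0].
(* The equality must hold at the origin too, where [0^-1 = 0] kills both sides if [q > 0]; for
   [q = 0] the weight is [1] and is treated apart. *)
- have [x0|x0] := eqVneq (sqnorm x) 0.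
    case: q {Z qN q2} => [|q]; last first.
      by rewrite x0 !exprS !mul0r !invr0 !(mulr0, mul0r, addr0).
    rewrite x0 !expr0 invr1; move: (u x) (euler u x) => a b; ring.
  rewrite exprS invfM; have sq0 : sqnorm x ^+ q != 0 by rewrite expf_neq0.
  move: (u x) (euler u x) (sqnorm x) x0 (_ ^+ q) sq0 => a b s s0 sq sq0.
  by field; rewrite s0 sq0.
- exact: radial_at_pow.
- have s0 : 0 < sqnorm x by rewrite sqnorm_gt0.
  rewrite ger0_norm ?invr_ge0 ?exprn_ge0 ?(ltW s0)//.
  by rewrite ler_peMl ?invr_ge0 ?exprn_ge0 ?(ltW s0)// lerDl.
- have s0 : 0 < sqnorm x by rewrite sqnorm_gt0.
  rewrite normrM normrN !ger0_norm ?invr_ge0 ?exprn_ge0 ?(ltW s0)//.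
  by rewrite ler_wpM2r ?invr_ge0 ?exprn_ge0 ?(ltW s0)// lerDr.
Qed.

(* The divergence of [2 phi |x|^(- 2 q) u^2 x]. *)
Lemma radial_hardy_log (q k : nat) : (0 < q)%N -> (2 * q < N)%N ->
  zero_integral (fun x => sqnorm x ^- q *
    (logsum k (relnorm D x) * ((N%:R - 2 * q%:R) * u x ^+ 2 + 2 * u x * euler u x)
     + (logsum k (relnorm D x) ^+ 2 + logsumsq k (relnorm D x)) / 2 * u x ^+ 2)).
Proof.
move=> q0 qN.
pose psi x := sqnorm x ^- q * logsum k (relnorm D x).
pose kappa x := - (2 * q%:R) * sqnorm x ^- q.+1 * logsum k (relnorm D x)
  + sqnorm x ^- q * slope_logsum D k x.
have q2 : 0 <= 2 * q%:R :> R by rewrite mulr_ge0.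
(* One constant for both bounds: [k] suffices for [psi] and [2 q k + (k^2 + k) / 2] for [kappa],
   since [logsum] and [logsumsq] are at most [k]. *)
pose C : R := (1 + 2 * q%:R) * k%:R + k%:R ^+ 2 + k%:R.
have Z := @radial_usq R N Om K A A1 OmA cK KOm N1 u su uK psi kappa q C qN.
apply: eq_zero_integral (Z _ _ _) => [x|x Omx x0|x Omx x0|x Omx x0].
- have [x0|x0] := eqVneq (sqnorm x) 0.
    case: q q0 @psi @kappa {Z qN q2 C} => [//|q] _ psi kappa.
    by rewrite /psi /kappa x0 !exprS !mul0r !invr0 !(mulr0, mul0r, addr0).
  have [Omx|nOm] := pselect (Om x); last by rewrite (uOm nOm) expr0n/= !(mulr0, mul0r, addr0).
  have xn0 : x != 0 by rewrite -sqnorm_eq0.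
  rewrite /psi /kappa (slope_logsumE D0 k xn0 (OmD Omx)).
  rewrite exprS invfM; have sq0 : sqnorm x ^+ q != 0 by rewrite expf_neq0.
  move: (u x) (euler u x) (sqnorm x) x0 (_ ^+ q) sq0 => a b s s0 sq sq0.
  move: (logsum _ _) (logsumsq _ _) => c d.
  by field; rewrite s0 sq0.
- have := OmD Omx => xD.
  exact: (radial_atM (radial_at_pow q x0) (radial_at_logsum D0 k x0 xD)).
- have s0 : 0 < sqnorm x by rewrite sqnorm_gt0.
  have /andP[z0 zk] := logsum_ge0_le k (relnorm_gt0_le1 D0 x0 (OmD Omx)).
  rewrite /psi ger0_norm ?mulr_ge0 ?invr_ge0 ?exprn_ge0 ?(ltW s0)//.
  rewrite mulrC ler_wpM2r ?invr_ge0 ?exprn_ge0 ?(ltW s0)//.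
  apply: (le_trans zk); rewrite /C mulrDl mul1r -!addrA lerDl.
  by rewrite !addr_ge0// mulr_ge0.
- have s0 : 0 < sqnorm x by rewrite sqnorm_gt0.
  have /andP[z0 zk] := logsum_ge0_le k (relnorm_gt0_le1 D0 x0 (OmD Omx)).
  have /andP[w0 wk] := logsumsq_ge0_le k (relnorm_gt0_le1 D0 x0 (OmD Omx)).
  rewrite /kappa (slope_logsumE D0 k x0 (OmD Omx)).
  rewrite (_ : _ + _ = (- (2 * q%:R) * logsum k (relnorm D x) +
    (logsum k (relnorm D x) ^+ 2 + logsumsq k (relnorm D x)) / 2) * sqnorm x ^- q.+1); last first.
    rewrite exprS invfM; have sq0 : sqnorm x ^+ q != 0 by rewrite expf_neq0// gt_eqF.
    have s1 : sqnorm x != 0 by rewrite gt_eqF.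
    move: (sqnorm x) s1 (_ ^+ q) sq0 (logsum _ _) (logsumsq _ _) => s s1 sq sq0 c d.
    by field; rewrite s1 sq0.
  rewrite normrM [`|_^-1|]ger0_norm ?invr_ge0 ?exprn_ge0 ?(ltW s0)//.
  rewrite ler_wpM2r ?invr_ge0 ?exprn_ge0 ?(ltW s0)//.
  apply: (le_trans (ler_normD _ _)).
  rewrite normrM normrN [`|2 * _|]ger0_norm// [`|logsum _ _|]ger0_norm//.
  rewrite ger0_norm; last by rewrite divr_ge0// addr_ge0// sqr_ge0.
  have z2 : logsum k (relnorm D x) ^+ 2 <= k%:R ^+ 2.
    by rewrite ler_sqr ?nnegrE.
  rewrite /C; move: (logsum _ _) (logsumsq _ _) z0 zk w0 wk z2 q2 => z w z0 zk w0 wk z2.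
  move: (2 * q%:R) => r r0.
  have : r * z <= r * k%:R by rewrite ler_wpM2l.
  have := sqr_ge0 (k%:R : R); have : 0 <= k%:R :> R by [].
  by move: (k%:R : R) zk wk z2 => m zk wk z2; lra.
Qed.

(** The integrand of a lower bound: [b] is the coefficient of the pure power term, [c] that of the
    logarithmic series cut after [k] terms. *)
Definition logweighted (b c : R) (q k : nat) x : R :=
  sqnorm x ^- q * ((b + c * logsumsq k (relnorm D x)) * u x ^+ 2).

Let Cu : C1 u. Proof. exact: smooth_C1. Qed.

Let continuous_usq : continuous (fun x => u x ^+ 2).
Proof.
move=> x; apply: (@continuous_comp _ _ _ u (fun r : R => r ^+ 2)).
  exact: C1_cont.
exact: exprn_continuous.
Qed.

Lemma continuous_logsumsq k x : x != 0 -> enorm x <= D ->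
  {for x, continuous (fun y : V => logsumsq k (relnorm D y))}.
Proof.
move=> x0 xD; elim: k => [|k IH].
  rewrite (_ : (fun _ => _) = cst 0); first exact: cst_continuous.
  by apply/funext => y; rewrite /logsumsq big_nil.
rewrite (_ : (fun _ => _) = (fun y => logsumsq k (relnorm D y)) \+
    (fun y => logprod k.+1 (relnorm D y) ^+ 2)); last first.
  by apply/funext => y; rewrite logsumsqS.
apply: (continuousD IH).
apply: (@continuous_comp _ _ _ (fun y => logprod k.+1 (relnorm D y)) (fun r : R => r ^+ 2)).
  by have [] := radial_at_logprod D0 k.+1 x0 xD.
exact: exprn_continuous.
Qed.

Lemma row_integrable_logweighted b c q k : (2 * q < N)%N -> row_integrable (logweighted b c q k).
Proof.
move=> qN.
pose psi x := sqnorm x ^- q * (b + c * logsumsq k (relnorm D x)).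
have cusq := continuous_usq.
have usqK : supported K (fun x => u x ^+ 2) by move=> x nK; rewrite uK// expr0n.
have [M M0 bM] := supported_bounded OmA KOm cusq usqK.
have -> : logweighted b c q k = fun x => psi x * u x ^+ 2.
  by apply/funext => x; rewrite /psi /logweighted mulrA.
apply: (@row_integrable_supported R N Om K A A1 OmA cK KOm psi (fun x => u x ^+ 2) q
  ((`|b| + `|c| * k%:R) * M) qN) => //.
- move=> x Omx x0.
  have [_ cpow _] := radial_at_pow q x0.
  apply: continuousM => //; apply: continuousD; first exact: cst_continuous.
  apply: continuousM; first exact: cst_continuous.
  exact: (continuous_logsumsq x0 (OmD Omx)).
- move=> x Omx x0; have s0 : 0 < sqnorm x by rewrite sqnorm_gt0.
  have /andP[w0 wk] := logsumsq_ge0_le k (relnorm_gt0_le1 D0 x0 (OmD Omx)).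
  rewrite /psi 2!normrM [`|_^-1|]ger0_norm ?invr_ge0 ?exprn_ge0 ?(ltW s0)//.
  rewrite -mulrA mulrC ler_wpM2r ?invr_ge0 ?exprn_ge0 ?(ltW s0)//.
  rewrite ler_pM//.
  apply: (le_trans (ler_normD _ _)); rewrite lerD2l normrM ler_wpM2l//.
  by rewrite ger0_norm.
Qed.

Lemma row_integrable_pow_sq f (q : nat) : (2 * q < N)%N -> continuous f -> supported K f ->
  row_integrable (fun x => sqnorm x ^- q * f x ^+ 2).
Proof.
move=> qN cf fK.
have cfsq : continuous (fun x => f x ^+ 2).
  move=> x; apply: (@continuous_comp _ _ _ f (fun r : R => r ^+ 2)); first exact: cf.
  exact: exprn_continuous.
have fsqK : supported K (fun x => f x ^+ 2) by move=> x nK; rewrite fK// expr0n.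
have [M M0 bM] := supported_bounded OmA KOm cfsq fsqK.
apply: (@row_integrable_supported R N Om K A A1 OmA cK KOm _ (fun x => f x ^+ 2) q M qN) => //.
- by move=> x Omx x0; have [] := radial_at_pow q x0.
- move=> x Omx x0; have s0 : 0 < sqnorm x by rewrite sqnorm_gt0.
  rewrite normrM mulrC [`|_^-1|]ger0_norm ?invr_ge0 ?exprn_ge0 ?(ltW s0)//.
  by rewrite ler_wpM2r ?invr_ge0 ?exprn_ge0 ?(ltW s0).
Qed.

(** In the notation of the overview, with [q = p + 1], once the four divergences are subtracted the
    difference of the integrands is, off the origin, [rho^-q] times [P^2 + 2 B (rho |grad u|^2 - (E
    u)^2) + c (A + phi u)^2]. The middle term is nonnegative by Cauchy-Schwarz. *)
Lemma rellich_truncated (p k : nat) : (0 < p)%N -> (2 * p.+1 < N)%N ->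
  (\int[mu]_t (logweighted (sigma (p%:R - 1) N%:R) (sigmabar (p%:R - 1) N%:R)
                 p.+1 k (row t))%:E
   <= \int[mu]_t (sqnorm (row t) ^- p.-1 * laplacian u (row t) ^+ 2)%:E)%E.
Proof.
move=> p0 pN.
pose n : R := N%:R; pose m : R := p%:R.
pose beta : R := (n - 2 * m - 2) / 2.
pose B : R := beta * (beta + 2 * m).
pose c : R := 4 * m ^+ 2 + 2 * B.
have beta0 : 0 <= beta.
  rewrite /beta divr_ge0// -addrA -opprD subr_ge0 /n /m -natrM -natrD ler_nat.
  by move: pN; rewrite mulnS addnC => /ltnW.
have m0 : 0 <= m by [].
have B0 : 0 <= B by rewrite mulr_ge0// addr_ge0// mulr_ge0.
have c0 : 0 <= c by rewrite addr_ge0// mulr_ge0// sqr_ge0.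
have Za := @pohozaev_identity R N Om K A A1 OmA cK KOm N1 u su uK p pN.
have Zb := @green_identity R N Om K A A1 OmA cK KOm N1 u su uK p pN.
have Zc := @radial_hardy p.+1 pN.
have Zd := @radial_hardy_log p.+1 k isT pN.
(* In [(rho Lap u)^2 - P^2] the factor [rho Lap u] multiplies [4 m E u + (4 m beta - 2 B) u]: these
   are the coefficients of [Za] and [Zb]. That of [Zc] adjusts the [u E u] term to the one in
   [c A^2], and [- (c / 2)] lets [Zd] complete the square to [c (A + phi u)^2]. *)
have Z := zero_integralD (zero_integralD (zero_integralZ (4 * m) Za) (zero_integralZ (4 * m * beta - 2 * B) Zb))
  (zero_integralD (zero_integralZ (2 * m * beta ^+ 2 - 2 * B * beta - 2 * m * B) Zc)
         (zero_integralZ (- (c / 2)) Zd)).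
apply: (@zero_integral_le R N (fun x => sqnorm x ^- p.-1 * laplacian u x ^+ 2) _ _ _ _ Z).
- have pN' : (2 * p.-1 < N)%N.
    apply: leq_ltn_trans pN; rewrite leq_mul2l/= (leq_trans (leq_pred p))//.
  apply: row_integrable_pow_sq => //.
    by apply: (fun H => H.1); exact/smooth_C1/smooth_laplacian.
  exact: supported_laplacian.
- exact: row_integrable_logweighted.
(* At the origin the weights on the left vanish, as [0^-1 = 0] and [p > 0], while the right-hand
   side is nonnegative. *)
move=> x; have [x0|x0] := eqVneq (sqnorm x) 0.
  case: p p0 @m @beta @B @c {pN Za Zb Zc Zd Z beta0 m0 B0 c0} => [//|p] _ m beta B c.
  have z0 (j : nat) : 0 ^- j.+1 = 0 :> R by rewrite expr0n invr0.
  rewrite /logweighted x0 !z0 !(mulr0, mul0r, addr0).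
  by rewrite mulr_ge0 ?sqr_ge0// invr_ge0 exprn_ge0.
have s0 : 0 < sqnorm x by rewrite lt_neqAle eq_sym x0 sqnorm_ge0.
have EG := euler_sq_le x.
(* For [s = p - 1] one has [N - 4 - 2 s = 2 beta] and [N + 2 s = 2 (beta + 2 p)], whence [B ^+ 2]
   here and [c / 4] for [sigmabar]. *)
have -> : sigma (p%:R - 1) N%:R = B ^+ 2 by rewrite /sigma /B /beta -/n -/m; field.
have -> : sigmabar (p%:R - 1) N%:R = c / 4 by rewrite /sigmabar /c /B /beta -/n -/m; field.
rewrite /logweighted.
have nE : N%:R = 2 * beta + 2 * m + 2 :> R by rewrite /beta -/n; field.
have pE : p.+1%:R = m + 1 :> R by rewrite -natr1.
rewrite nE pE.
have wp0 : 0 < sqnorm x ^+ p.-1 by rewrite exprn_gt0.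
have E1 : sqnorm x ^+ p = sqnorm x * sqnorm x ^+ p.-1 by rewrite -exprS prednK.
have E2 : sqnorm x ^+ p.+1 = sqnorm x * (sqnorm x * sqnorm x ^+ p.-1).
  by rewrite exprS E1.
rewrite E1 E2 -/m.
move: (sqnorm x ^+ p.-1) wp0 {E1 E2} => w w0.
move: (sqnorm x) x0 s0 (u x) (euler u x) (gradsq u x) (laplacian u x) EG.
move: (logsum _ _) (logsumsq _ _) => z y s sn0 s0 a E G L EG.
rewrite -subr_ge0.
pose P := s * L - 2 * m * (E + beta * a) + B * a.
have sw0 : 0 < s * (s * w) by rewrite !mulr_gt0.
rewrite [leRHS](_ : _ = (s * (s * w))^-1 * (P ^+ 2 + 2 * B * (s * G - E ^+ 2)
    + c * (E + beta * a + z * a / 2) ^+ 2)).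
  rewrite mulr_ge0 ?invr_ge0 ?(ltW sw0)// !addr_ge0 ?sqr_ge0//.
    apply: mulr_ge0; last by rewrite subr_ge0.
    by rewrite mulr_ge0.
  by rewrite mulr_ge0// sqr_ge0.
rewrite /P /c /B.
by field; rewrite sn0 gt_eqF.
Qed.

(** The same scheme with [q = 1]: what remains is [rho^-1] times [(rho |grad u|^2 - (E u)^2) + (E u
    + beta u + phi u)^2]. *)
Lemma hardy_truncated (k : nat) : (2 < N)%N ->
  (\int[mu]_t (logweighted (((N%:R - 2) / 2) ^+ 2) (1 / 4) 1 k (row t))%:E
   <= \int[mu]_t (gradsq u (row t))%:E)%E.
Proof.
move=> N2.
pose beta : R := (N%:R - 2) / 2.
have Zc := @radial_hardy 1 N2.
have Zd := @radial_hardy_log 1 k isT N2.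
have Z := zero_integralD (zero_integralZ (- beta) Zc) (zero_integralZ (- 2^-1) Zd).
have [CQ _] := C1_gradsq su.
have QK := supported_gradsq cK uK.
apply: (@zero_integral_le R N (gradsq u) _ _ _ _ Z).
- have cQ : continuous (gradsq u) by case: CQ.
  have [M M0 bM] := supported_bounded OmA KOm cQ QK.
  have -> : gradsq u = (fun x => cst 1 x * gradsq u x).
    by apply/funext => x; rewrite mul1r.
  apply: (@row_integrable_supported R N Om K A A1 OmA cK KOm (cst 1) (gradsq u) 0 M) => //.
  + exact: leq_trans N2.
  + by move=> x _ _; exact: cst_continuous.
  + by move=> x _ _; rewrite mul1r expr0 invr1 mulr1.
- exact: row_integrable_logweighted.
move=> x; have [x0|x0] := eqVneq (sqnorm x) 0.
  rewrite /logweighted x0 expr1 invr0 !(mulr0, mul0r, addr0).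
  by apply: sumr_ge0 => j _; rewrite -expr2 sqr_ge0.
have s0 : 0 < sqnorm x by rewrite lt_neqAle eq_sym x0 sqnorm_ge0.
have EG := euler_sq_le x.
rewrite /logweighted -/beta expr1.
have nE : N%:R = 2 * beta + 2 :> R by rewrite /beta; field.
rewrite nE.
move: (sqnorm x) x0 s0 (u x) (euler u x) (gradsq u x) EG.
move: (logsum _ _) (logsumsq _ _) => z y s sn0 s0 a E G EG.
rewrite -subr_ge0.
rewrite [leRHS](_ : _ = s^-1 * ((s * G - E ^+ 2) + (E + beta * a + z * a / 2) ^+ 2)).
  by rewrite mulr_ge0 ?invr_ge0 ?(ltW s0)// addr_ge0 ?sqr_ge0// subr_ge0.
by field.
Qed.

End Inequalities.

(** * Limits of the truncated inequalities *)

Section ExtendedRealLemmas.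
Context {R : realType}.
Local Open Scope ereal_scope.

(** Finiteness of [I] allows its term to be moved to the other side, after which the partial sums
    pass to the limit. *)
Lemma truncations_le_series (a : nat -> \bar R) (I J : \bar R) (b c : R) :
  (forall i, 0 <= a i) -> (0 <= c)%R -> I \is a fin_num ->
  (forall k, b%:E * I + c%:E * \sum_(1 <= i < k.+1) a i <= J) ->
  b%:E * I + c%:E * \sum_(1 <= i <oo) a i <= J.
Proof.
move=> a0 c0 If H.
rewrite -leeBrDl; last by rewrite fin_numM.
rewrite -nneseriesZl; last by move=> i _.
apply: lime_le.
  by apply: is_cvg_nneseries => i _ _; rewrite mule_ge0.
(* The partial sum of rank [n] runs over [1 <= i < n]: ranks [0] and [1] are both empty, so rank [0]
   also follows from [H 0]. *)
apply: nearW => -[|k].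
  rewrite big_geq// leeBrDl; last by rewrite fin_numM.
  by have := H 0%N; rewrite big_geq// mule0.
rewrite leeBrDl; last by rewrite fin_numM.
by rewrite -ge0_sume_distrr.
Qed.

(** The last inequality of the chain is multiplied by the product of the earlier [s k] and
    substituted for [J n]. Signs are required because multiplication of extended reals distributes
    over sums of nonnegative terms. *)
Lemma iterate_inequality (J L : nat -> \bar R) (s t : nat -> R) (n : nat) :
  (forall k, 0 <= J k) -> (forall k, 0 <= L k) ->
  (forall k, (k < n)%N -> (0 <= s k)%R) -> (forall k, (k < n)%N -> (0 <= t k)%R) ->
  (forall k, (k < n)%N -> (s k)%:E * J k.+1 + (t k)%:E * L k <= J k) ->
  (\prod_(0 <= k < n) s k)%R%:E * J n
    + \sum_(0 <= k < n) (t k * \prod_(0 <= j < k) s j)%R%:E * L k <= J 0%N.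
Proof.
move=> J0 L0; elim: n => [|n IH] s0 t0 H.
  by rewrite !big_geq// mul1e adde0.
apply: le_trans (IH _ _ _); last first.
- by move=> k kn; apply: H; exact: ltnW.
- by move=> k kn; apply: t0; exact: ltnW.
- by move=> k kn; apply: s0; exact: ltnW.
have P0 : (0 <= \prod_(0 <= k < n) s k)%R.
  rewrite big_nat; apply: prodr_ge0 => k /andP[_ kn]; apply: s0; exact: ltnW.
rewrite !big_nat_recr//= addeA addeAC leeD2r//.
apply: (@le_trans _ _ ((\prod_(0 <= k < n) s k)%:E * ((s n)%:E * J n.+1 + (t n)%:E * L n))).
  rewrite ge0_muleDr ?mule_ge0 ?lee_fin ?s0 ?t0//.
  by rewrite !muleA -!EFinM [(t n * _)%R]mulrC.
by rewrite lee_pmul// ?lee_fin// ?H// adde_ge0// mule_ge0// lee_fin ?s0 ?t0.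
Qed.

End ExtendedRealLemmas.

(** * One step of each inequality, with the full series *)

Section Steps.
Context {R : realType} {N : nat}.
Local Notation V := 'rV[R]_N.
Local Notation row := (@row_of_tuple R N).
Local Notation mu := (@lebesgueN R N).
Implicit Types (x : V) (f g : V -> R).
Variables (Om K : set V) (A : R).
Hypotheses (A1 : 1 < A) (OmA : forall x, Om x -> forall i, `|x 0 i| <= A).
Hypotheses (cK : closed K) (KOm : K `<=` Om) (N1 : (1 < N)%N).
Variable D : R.
Hypotheses (D0 : 0 < D) (OmD : forall x, Om x -> enorm x <= D).

Lemma eq_row_integrable f g : f =1 g -> row_integrable f -> row_integrable g.
Proof. by move=> /funext ->. Qed.

Lemma integral_rVE f : (forall x, ~ Om x -> f x = 0) ->
  integral_rV Om f = (\int[mu]_t (f (row t))%:E)%E.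
Proof.
move=> f0; rewrite /integral_rV integral_mkcond; apply: eq_integral => t _.
by rewrite patchE; case: ifPn => //; rewrite notin_setE/= => /f0 ->.
Qed.

Lemma enorm_even_pow x q : enorm x ^+ (2 * q) = sqnorm x ^+ q.
Proof. by rewrite exprM enorm_sqnorm. Qed.

Definition logterm f (p i : nat) x : R :=
  f x ^+ 2 / enorm x ^+ p * \prod_(1 <= j < i.+1) Xk j (enorm x / D) ^+ 2.

Lemma logterm_ge0 f p i x : 0 <= logterm f p i x.
Proof.
apply: mulr_ge0; last by apply: prodr_ge0 => j _; exact: sqr_ge0.
by rewrite divr_ge0 ?sqr_ge0// exprn_ge0// enorm_ge0.
Qed.

Lemma integral_rV_ge0 f : (forall x, 0 <= f x) -> (0 <= integral_rV Om f)%E.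
Proof. by move=> f0; apply: integral_ge0 => t _; rewrite lee_fin. Qed.

Lemma log_series_ge0 f p : (0 <= log_series Om D f p)%E.
Proof.
apply: nneseries_ge0 => i _ _; apply: integral_rV_ge0 => x.
exact: logterm_ge0.
Qed.

Variable u : V -> R.
Hypotheses (su : smooth u) (uK : supported K u).

Let uOm x : ~ Om x -> u x = 0.
Proof. by move=> nO; apply: uK => /KOm. Qed.

Lemma logweighted0E b c q x :
  logweighted D u b c q 0 x = b * (u x ^+ 2 / enorm x ^+ (2 * q)).
Proof.
by rewrite /logweighted /logsumsq big_geq// mulr0 addr0 enorm_even_pow mulrCA [_ * _^-1]mulrC.
Qed.

Lemma logweightedS b c q k x :
  logweighted D u b c q k.+1 x =
  logweighted D u b c q k x + c * logterm u (2 * q) k.+1 x.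
Proof.
rewrite /logweighted /logterm logsumsqS enorm_even_pow prodrXl -logprodE.
by rewrite -/(relnorm D x); move: (logprod _ _) (logsumsq _ _) => y w; ring.
Qed.

Lemma integral_logweighted b c q k : (2 * q < N)%N ->
  (\int[mu]_t (logweighted D u b c q k (row t))%:E =
   b%:E * integral_rV Om (fun x => (u x ^+ 2 / enorm x ^+ (2 * q))%R)
   + c%:E * \sum_(1 <= i < k.+1) integral_rV Om (logterm u (2 * q) i))%E.
Proof.
move=> qN.
have I b' c' k' := @row_integrable_logweighted R N Om K A A1 OmA cK KOm D D0 OmD u su uK b' c' q k' qN.
elim: k => [|k IH].
  rewrite big_geq// mule0 adde0 integral_rVE; last first.
    by move=> x /uOm ->; rewrite expr0n mul0r.
  have I1 : row_integrable (fun x => u x ^+ 2 / enorm x ^+ (2 * q)).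
    by apply: eq_row_integrable (I 1 0 0%N) => x; rewrite logweighted0E mul1r.
  under eq_integral do rewrite logweighted0E EFinM.
  by rewrite (integralZl measurableT I1).
(* A single logarithmic term is the difference of two consecutive truncations, both integrable. *)
have It : row_integrable (logterm u (2 * q) k.+1).
  apply: eq_row_integrable (row_integrableD (I 0 1 k.+1) (row_integrableZ (-1) (I 0 1 k))) => x.
  by rewrite logweightedS mul1r mulN1r addrAC subrr add0r.
under eq_integral do rewrite logweightedS EFinD.
rewrite (integralD measurableT (I b c k) (row_integrableZ c It)) IH.
have -> : (\int[mu]_t (EFin \o ((fun x => c * logterm u (2 * q) k.+1 x)%R \o row)) t =
    c%:E * integral_rV Om (logterm u (2 * q) k.+1))%E.
  rewrite integral_rVE; last first.
    by move=> x /uOm ux; rewrite /logterm ux expr0n !mul0r.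
  exact: (integralZl measurableT It c).
rewrite [in RHS]big_nat_recr//=.
have T0 : (0 <= integral_rV Om (logterm u (2 * q) k.+1))%E.
  by apply: integral_rV_ge0 => x; exact: logterm_ge0.
have S0 : (0 <= \sum_(1 <= i < k.+1) integral_rV Om (logterm u (2 * q) i))%E.
  by apply: sume_ge0 => i _; apply: integral_rV_ge0 => x; exact: logterm_ge0.
move: T0 S0; move: (b%:E * _)%E (\sum_(1 <= i < k.+1) _)%E (integral_rV _ _).
by move=> B S T T0 S0; rewrite ge0_muleDr// addeA.
Qed.

Lemma integral_pow_fin_num q : (2 * q < N)%N ->
  integral_rV Om (fun x => u x ^+ 2 / enorm x ^+ (2 * q)) \is a fin_num.
Proof.
move=> qN.
have I := @row_integrable_logweighted R N Om K A A1 OmA cK KOm D D0 OmD u su uK 1 0 q 0 qN.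
have -> : integral_rV Om (fun x => u x ^+ 2 / enorm x ^+ (2 * q)) =
    (\int[mu]_t (logweighted D u 1 0 q 0 (row t))%:E)%E.
  rewrite integral_rVE; last by move=> x /uOm ->; rewrite expr0n mul0r.
  by apply: eq_integral => t _; rewrite logweighted0E mul1r.
exact: (integrable_fin_num measurableT I).
Qed.

Lemma log_inequality b c q (J : \bar R) : (2 * q < N)%N -> 0 <= c ->
  (forall k, (\int[mu]_t (logweighted D u b c q k (row t))%:E <= J)%E) ->
  (b%:E * integral_rV Om (fun x => (u x ^+ 2 / enorm x ^+ (2 * q))%R)
   + c%:E * log_series Om D u (2 * q) <= J)%E.
Proof.
move=> qN c0 H; apply: truncations_le_series => //.
- by move=> i; apply: integral_rV_ge0 => x; exact: logterm_ge0.
- exact: integral_pow_fin_num.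
- by move=> k; rewrite -integral_logweighted.
Qed.

Lemma rellich_step (p : nat) : (0 < p)%N -> (2 * p.+1 < N)%N ->
  ((sigma (p%:R - 1) N%:R)%:E
     * integral_rV Om (fun x => (u x ^+ 2 / enorm x ^+ (2 * p.+1))%R)
   + (sigmabar (p%:R - 1) N%:R)%:E * log_series Om D u (2 * p.+1)
   <= integral_rV Om (fun x => (laplacian u x ^+ 2 / enorm x ^+ (2 * p.-1))%R))%E.
Proof.
move=> p0 pN; apply: log_inequality => //.
  (* This is [N - 4 - 2 s >= 0] for [s = p - 1], which makes [sigmabar] nonnegative. *)
  have pN' : (2 * p.+1)%:R <= N%:R :> R by rewrite ler_nat ltnW.
  have p1 : 1 <= p%:R :> R by rewrite ler1n.
  rewrite natrM -[p.+1%:R]natr1 in pN'.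
  apply: addr_ge0; first exact: sqr_ge0.
  by apply: divr_ge0 => //; apply: mulr_ge0; move: (N%:R) (p%:R) p1 pN' => n r; lra.
move=> k; apply: (le_trans (rellich_truncated A1 OmA cK KOm N1 D0 OmD su uK k p0 pN)).
rewrite integral_rVE; last first.
  move=> x nOm; rewrite (supported_laplacian cK uK) ?expr0n ?mul0r//.
  by move=> /KOm.
rewrite le_eqVlt; apply/orP; left; apply/eqP; apply: eq_integral => t _.
by rewrite enorm_even_pow mulrC.
Qed.

Lemma hardy_step : (2 < N)%N ->
  ((((N%:R - 2) / 2) ^+ 2)%:E
     * integral_rV Om (fun x => (u x ^+ 2 / enorm x ^+ 2)%R)
   + (1 / 4)%:E * log_series Om D u 2
   <= integral_rV Om (fun x => (enorm (gradient u x) ^+ 2)%R))%E.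
Proof.
move=> N2; apply: (@log_inequality _ _ 1) => //.
have E x : enorm (gradient u x) ^+ 2 = gradsq u x.
  rewrite enorm_sqnorm /sqnorm /gradsq; apply: eq_bigr => j _.
  by rewrite mxE expr2.
move=> k; apply: (le_trans (hardy_truncated A1 OmA cK KOm N1 D0 OmD su uK k N2)).
rewrite integral_rVE; last first.
  move=> x nOm; rewrite E (supported_gradsq cK uK)//.
  by move=> /KOm.
by rewrite le_eqVlt; apply/orP; left; apply/eqP; apply: eq_integral => t _; rewrite E.
Qed.

End Steps.

(** * Iteration over powers of the Laplacian *)

Section Chains.
Context {R : realType} {N : nat}.
Local Notation V := 'rV[R]_N.
Variables (Om K : set V) (A : R).
Hypotheses (A1 : 1 < A) (OmA : forall x : V, Om x -> forall i, `|x 0 i| <= A).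
Hypotheses (cK : closed K) (KOm : K `<=` Om).
Variable D : R.
Hypotheses (D0 : 0 < D) (OmD : forall x, Om x -> enorm x <= D).
Variable u : V -> R.
Hypotheses (su : smooth u) (uK : supported K u).
Variable m : nat.
Hypothesis mN : (4 * m < N)%N.

Local Notation Delta k := (iter k laplacian u).

Lemma smooth_iter_laplacian k : smooth (Delta k).
Proof. by elim: k => [|k IH]; [exact: su|exact: (smooth_laplacian IH)]. Qed.

Lemma supported_iter_laplacian k : supported K (Delta k).
Proof. by elim: k => [|k IH]; [exact: uK|exact: (supported_laplacian cK IH)]. Qed.

Lemma sigma_ge0 (s n : R) : 0 <= sigma s n.
Proof. exact: sqr_ge0. Qed.

Lemma sigmabar_ge0 (s : R) : 0 <= s -> 4 + 2 * s <= N%:R -> 0 <= sigmabar s N%:R.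
Proof.
move=> s0 sN; apply: addr_ge0; first exact: sqr_ge0.
by apply: divr_ge0 => //; apply: mulr_ge0; move: (N%:R) sN => n sN; lra.
Qed.

(* The steps of the chain use the weights [|x|^-e, |x|^-(e+4), ...] with
   [e = 0] for (i) and [e = 2] for (ii). *)
Lemma rellich_chain (e l : nat) : (e <= 1)%N -> (l + e <= m)%N ->
  ((\prod_(0 <= k < l) sigma (2 * k%:R + e%:R) N%:R)%:E
     * integral_rV Om (fun x => (Delta (m - l)%N x ^+ 2 / enorm x ^+ (4 * l + 2 * e))%R)
   + \sum_(0 <= k < l)
       (sigmabar (2 * k%:R + e%:R) N%:R
          * \prod_(0 <= j < k) sigma (2 * j%:R + e%:R) N%:R)%:E
         * log_series Om D (Delta (m - k - 1)%N) (4 * k + 4 + 2 * e)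
   <= integral_rV Om (fun x => (Delta m x ^+ 2 / enorm x ^+ (2 * e))%R))%E.
Proof.
move=> e1 lm.
pose J k := integral_rV Om (fun x => Delta (m - k)%N x ^+ 2 / enorm x ^+ (4 * k + 2 * e)).
pose L k := log_series Om D (Delta (m - k - 1)%N) (4 * k + 4 + 2 * e).
have := @iterate_inequality R J L (fun k => sigma (2 * k%:R + e%:R) N%:R)
  (fun k => sigmabar (2 * k%:R + e%:R) N%:R) l.
rewrite /J /L subn0 muln0 add0n; apply.
- move=> k; apply: integral_rV_ge0 => x.
  by rewrite divr_ge0 ?sqr_ge0// exprn_ge0// enorm_ge0.
- by move=> k; exact: log_series_ge0.
- by move=> k _; exact: sigma_ge0.
- move=> k kl; apply: sigmabar_ge0; first by rewrite addr_ge0// mulr_ge0.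
  have : (4 + 2 * (2 * k + e))%:R <= N%:R :> R.
    by rewrite ler_nat; move: kl lm mN e1; clear; lia.
  by rewrite natrD natrM natrD natrM.
(* Step [k] takes [p = 2 k + e + 1], so that [p - 1] is the argument of [sigma] and the weight on
   the right is [|x|^-(4 k + 2 e)]. *)
- move=> k kl; have := @rellich_step R N Om K A A1 OmA cK KOm _ D D0 OmD
    (Delta (m - k - 1)%N) (smooth_iter_laplacian _) (supported_iter_laplacian _) (2 * k + e).+1.
  have pE : (2 * k + e).+1%:R - 1 = 2 * k%:R + e%:R :> R.
    by rewrite -natr1 addrK natrD natrM.
  have e1E : (2 * (2 * k + e).+2 = 4 * k + 4 + 2 * e)%N by clear; lia.
  have e2E : (4 * k.+1 + 2 * e = 4 * k + 4 + 2 * e)%N by clear; lia.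
  have e3E : (2 * (2 * k + e).+1.-1 = 4 * k + 2 * e)%N by clear; lia.
  rewrite pE e1E e3E -iterS e2E.
  have -> : (m - k.+1 = m - k - 1)%N by clear; lia.
  have -> : ((m - k - 1).+1 = m - k)%N by move: kl lm; clear; lia.
  by apply => //; move: kl lm mN e1; clear; lia.
Qed.

(** The chain with [e = 0] and [l + 1] steps. Its term [k = 0] has an empty product and
    [sigmabar 0 N = 1 + N (N - 4) / 8]: it is the separate last term. *)
Lemma rellich_inequality (l : nat) : (l < m)%N ->
  (integral_rV Om (fun x => (Delta m x ^+ 2)%R) >=
     (\prod_(0 <= k < l.+1)
        ((N%:R + 4 * k%:R) * (N%:R - 4 - 4 * k%:R) / 4) ^+ 2)%:E
       * integral_rV Om
           (fun x => (Delta (m - l - 1)%N x ^+ 2 / enorm x ^+ (4 * l + 4))%R)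
     + \sum_(1 <= k < l.+1)
         (sigmabar (2 * k%:R) N%:R * \prod_(0 <= j < k) sigma (2 * j%:R) N%:R)%:E
           * log_series Om D (Delta (m - k - 1)%N) (4 * k + 4)
     + (1 + N%:R * (N%:R - 4) / 8)%:E * log_series Om D (Delta (m - 1)%N) 4)%E.
Proof.
move=> lm; have := @rellich_chain 0 l.+1 isT.
rewrite addn0 => /(_ lm).
rewrite [X in (_ <= X)%E -> _](_ : _ = integral_rV Om (fun x => (Delta m x ^+ 2)%R)); last first.
  by congr integral_rV; apply/funext => x; rewrite expr0 divr1.
apply: le_trans; rewrite le_eqVlt; apply/orP; left; apply/eqP.
rewrite -addeA; congr (_ * _ + _)%E.
- congr (_%:E); apply: eq_bigr => k _; rewrite /sigma; congr (_ ^+ 2); ring.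
- congr integral_rV; apply/funext => x.
  by rewrite -subnDA addn1 mulnS addn0 addnC.
rewrite [in RHS]big_nat_recl// addeC; congr (_ + _)%E.
  rewrite big_geq// mulr1 subn0; congr (_%:E * _)%E.
  by rewrite /sigmabar; field.
rewrite big_add1/=; apply: eq_bigr => k _.
rewrite addr0 addn0; congr ((_ * _)%:E * _)%E.
by apply: eq_bigr => j _; rewrite addr0.
Qed.

(** Hardy's inequality for [Delta m] gives the series with factor [1 / 4]; its power term, with
    weight [|x|^-2], starts the chain with [e = 1] and [l] steps. *)
Lemma hardy_rellich_inequality (l : nat) : (l < m)%N ->
  (integral_rV Om (fun x => (enorm (gradient (Delta m) x) ^+ 2)%R) >=
     (((N%:R - 2) / 2) ^+ 2 * \prod_(0 <= k < l)
        ((N%:R + 2 + 4 * k%:R) * (N%:R - 6 - 4 * k%:R) / 4) ^+ 2)%:E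
       * integral_rV Om
           (fun x => (Delta (m - l)%N x ^+ 2 / enorm x ^+ (4 * l + 2))%R)
     + (((N%:R - 2) / 2) ^+ 2)%:E * \sum_(2 <= k < l.+1)
         (sigmabar (2 * k%:R - 1) N%:R
            * \prod_(0 <= j < k.-1) sigma (2 * j%:R + 1) N%:R)%:E
           * log_series Om D (Delta (m - k)%N) (4 * k + 2)
     + (if (0 < l)%N then
          (((N%:R - 2) / 2) ^+ 2 * (4 + (N%:R + 2) * (N%:R - 6) / 8))%:E
            * log_series Om D (Delta (m - 1)%N) 6
        else 0)
     + (1 / 4)%:E * log_series Om D (Delta m) 2)%E.
Proof.
move=> lm; set C : R := ((N%:R - 2) / 2) ^+ 2.
have C0 : 0 <= C by exact: sqr_ge0.
have N2 : (2 < N)%N by move: lm mN; clear; lia.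
have := @hardy_step R N Om K A A1 OmA cK KOm (ltnW N2) D D0 OmD (Delta m)
  (smooth_iter_laplacian m) (supported_iter_laplacian m) N2.
apply: le_trans; apply: leeD2r.
have := @rellich_chain 1 l isT; rewrite addn1 => /(_ lm).
move=> /(lee_wpmul2l (C0 : (0 <= C%:E)%E)); apply: le_trans.
set I := integral_rV Om (fun x => _ / enorm x ^+ (4 * l + 2)).
have I0 : (0 <= I)%E.
  apply: integral_rV_ge0 => x.
  by rewrite divr_ge0 ?sqr_ge0// exprn_ge0// enorm_ge0.
have P0 : 0 <= \prod_(0 <= k < l) sigma (2 * k%:R + 1) N%:R :> R.
  by apply: prodr_ge0 => k _; exact: sigma_ge0.
have PE : \prod_(0 <= k < l) ((N%:R + 2 + 4 * k%:R) * (N%:R - 6 - 4 * k%:R) / 4) ^+ 2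
    = \prod_(0 <= k < l) sigma (2 * k%:R + 1) N%:R :> R.
  by apply: eq_bigr => k _; rewrite /sigma; congr (_ ^+ 2); ring.
rewrite PE.
(* Nonnegative summands let the Hardy constant [C] be distributed over the chain. *)
have term0 k : (k < l)%N -> (0 <= (sigmabar (2 * k%:R + 1) N%:R
          * \prod_(0 <= j < k) sigma (2 * j%:R + 1) N%:R)%:E
         * log_series Om D (Delta (m - k - 1)%N) (4 * k + 6))%E.
  move=> kl; apply: mule_ge0; last exact: log_series_ge0.
  rewrite lee_fin mulr_ge0//; last by apply: prodr_ge0 => j _; exact: sigma_ge0.
  apply: sigmabar_ge0; first by rewrite addr_ge0// mulr_ge0.
  have : (4 + 2 * (2 * k + 1))%:R <= N%:R :> R.
    by rewrite ler_nat; move: kl lm mN; clear; lia.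
  by rewrite natrD natrM natrD natrM.
rewrite [leRHS]ge0_muleDr; last 2 first.
- by apply: mule_ge0; [rewrite lee_fin|exact: I0].
- rewrite big_nat; apply: sume_ge0 => k /andP[_ kl].
  by rewrite -addnA; exact: term0.
rewrite -addeA muleA -EFinM; apply: leeD2l.
(* For [l = 0] the chain is empty. Otherwise its first term is the one with [|x|^-6], where
   [sigmabar 1 N = 4 + (N + 2) (N - 6) / 8]. *)
case: l lm @I I0 P0 PE term0 => [|l] lm I I0 P0 PE term0.
  by rewrite !big_geq// adde0.
rewrite [in leRHS]big_nat_recl//= [leRHS]ge0_muleDr; last 2 first.
- by have := term0 0%N isT; rewrite muln0 subn0.
- rewrite big_nat; apply: sume_ge0 => k /andP[_ kl].
  by rewrite -addnA; exact: term0.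
rewrite addeC le_eqVlt; apply/orP; left; apply/eqP; congr (_ + _ * _)%E.
  rewrite big_geq// mulr1 subn0 muleA -EFinM; congr ((_ * _)%:E * _)%E.
  by rewrite /sigmabar; field.
(* The chain counts from 0 and the statement from 1: chain index [k + 1] is index [k + 2] there. *)
rewrite big_add1/= big_add1/=; apply: eq_bigr => k _.
have -> : 2 * k.+2%:R - 1 = 2 * k.+1%:R + 1 :> R by rewrite -[k.+2%:R]natr1; ring.
have -> : (4 * k.+2 + 2 = 4 * k.+1 + 4 + 2 * 1)%N by clear; lia.
by have -> : (m - k.+2 = m - k.+1 - 1)%N by clear; lia.
Qed.

End Chains.

(** * Constants attached to a bounded domain, and conclusion *)

Unset Implicit Arguments.

Theorem theorem1p9 (R : realType) (N m l : nat) (hl : (l < m)%N)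
    (hN : (4 * m < N)%N) (Omega : set 'rV[R]_N) (hOmega : bounded_domain Omega)
    (h0 : Omega 0) (D : R) (hD : sup [set enorm x | x in Omega] <= D)
    (u : 'rV[R]_N -> R) (hu : test_function Omega u) :
  let n : R := N%:R in
  let Delta (k : nat) : 'rV[R]_N -> R := iter k laplacian u in
  (integral_rV Omega (fun x => (Delta m x ^+ 2)%R) >=
     (\prod_(0 <= k < l.+1)
        ((n + 4 * k%:R) * (n - 4 - 4 * k%:R) / 4) ^+ 2)%:E
       * integral_rV Omega
           (fun x => (Delta (m - l - 1)%N x ^+ 2 / enorm x ^+ (4 * l + 4))%R)
     + \sum_(1 <= k < l.+1)
         (sigmabar (2 * k%:R) n * \prod_(0 <= j < k) sigma (2 * j%:R) n)%:E
           * log_series Omega D (Delta (m - k - 1)%N) (4 * k + 4)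
     + (1 + n * (n - 4) / 8)%:E * log_series Omega D (Delta (m - 1)%N) 4)%E
  /\
  (integral_rV Omega (fun x => (enorm (gradient (Delta m) x) ^+ 2)%R) >=
     (((n - 2) / 2) ^+ 2 * \prod_(0 <= k < l)
        ((n + 2 + 4 * k%:R) * (n - 6 - 4 * k%:R) / 4) ^+ 2)%:E
       * integral_rV Omega
           (fun x => (Delta (m - l)%N x ^+ 2 / enorm x ^+ (4 * l + 2))%R)
     + (((n - 2) / 2) ^+ 2)%:E * \sum_(2 <= k < l.+1)
         (sigmabar (2 * k%:R - 1) n
            * \prod_(0 <= j < k.-1) sigma (2 * j%:R + 1) n)%:E
           * log_series Omega D (Delta (m - k)%N) (4 * k + 2)
     (* the k = 1 term of the preceding sum: absent when l = 0 *)
     + (if (0 < l)%N then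
          (((n - 2) / 2) ^+ 2 * (4 + (n + 2) * (n - 6) / 8))%:E
            * log_series Omega D (Delta (m - 1)%N) 6
        else 0)
     + (1 / 4)%:E * log_series Omega D (Delta m) 2)%E.
Proof.
move=> n Delta; case: hOmega => oOm _ _ [M [Mreal MB]].
case: hu => su _ KOm; set K := closure _ in KOm.
have cK : closed K by exact: closed_closure.
have uK : supported K u.
  move=> x nK; apply/eqP/negPn/negP => ux; apply: nK; exact: subset_closure.
(* Boundedness supplies a bound by every real above [M]; adding 2 exceeds [M] and secures
   [1 < A]. *)
pose A : R := `|M| + 2.
have A1 : 1 < A by rewrite /A; have := normr_ge0 M; lra.
have OmA (x : 'rV[R]_N) : Omega x -> forall i, `|x 0 i| <= A.
  move=> Omx i; apply: (@le_trans _ _ `|x|).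
    rewrite [leRHS]/Num.norm /= mx_normrE; apply/bigmax_geP; right.
    by exists (ord0, i).
  by apply: MB => //; rewrite /A; have := ler_norm M; lra.
(* [sup] is an upper bound only for a set known to be bounded above. *)
have ubOm : has_ubound [set enorm x | x in Omega].
  exists (Num.sqrt (N%:R * A ^+ 2)) => _ [x Omx <-].
  by apply: ler_wsqrtr; exact: (sqnorm_bounded A1 OmA Omx).
have OmD x : Omega x -> enorm x <= D.
  by move=> Omx; apply: le_trans hD; apply: ub_le_sup => //; exists x.
(* [Omega] is a neighbourhood of [0] and [N > 0], so it contains a nonzero point, whose norm is at
   most [D]. *)
have D0 : 0 < D.
  have N0 : (0 < N)%N by exact: leq_ltn_trans hN.
  have /nbhs_ballP[e /= e0 eOm] : nbhs (0 : 'rV[R]_N) Omega by exact: open_nbhs_nbhs.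
  pose x : 'rV[R]_N := \row__ (e / 2).
  have Omx : Omega x.
    apply: eOm; split=> // i j; rewrite !mxE -ball_normE/= sub0r normrN.
    by rewrite gtr0_norm ?divr_gt0//; lra.
  apply: lt_le_trans (OmD x Omx); rewrite enorm_gt0.
  apply/eqP => /rowP/(_ (Ordinal N0)); rewrite !mxE => /eqP.
  by rewrite gt_eqF// divr_gt0.
split.
- exact: (rellich_inequality A1 OmA cK KOm D0 OmD su uK hN hl).
- exact: (hardy_rellich_inequality A1 OmA cK KOm D0 OmD su uK hN hl).
Qed.
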